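(* Let $k$ be a field, let $a,b,c$ be positive integers with $\gcd(a,b,c)=1$, and let $R=k[\![t^a,t^b,t^c]\!]$ be the associated $3$-generated numerical semigroup ring. Then $$\mathrm{bideg}(R)\le \mathrm{cdeg}(R),$$ where $\mathrm{bideg}(R)$ is the bi-canonical degree and $\mathrm{cdeg}(R)$ is the canonical degree of $R$.
   Context: Here $k[\![t]\!]$ is the formal power series ring and $k[\![t^a,t^b,t^c]\!]$ denotes the subring generated by $t^a,t^b,t^c$ (the semigroup ring of the numerical semigroup $\langle a,b,c\rangle$ over $k$, i.e. the image of the $k$-algebra homomorphism $k[\![X,Y,Z]\!]\to k[\![t]\!]$, $X\mapsto t^a$, $Y\mapsto t^b$, $Z\mapsto t^c$). It is a one-dimensional Cohen-Macaulay local domain with a canonical ideal. Let $(R,\mathfrak m)$ be a $1$-dimensional Cohen-Macaulay local ring with a canonical ideal $\mathcal C$, that is, a (proper, $\mathfrak m$-primary) ideal of $R$ isomorphic to a canonical module of $R$. Write $\lambda$ for length. The canonical degree of $R$ is the integer $\mathrm{cdeg}(R)=e_0(\mathcal C)-\lambda(R/\mathcal C)$, where $e_0(\mathcal C)$ is the multiplicity of the $\mathfrak m$-primary ideal $\mathcal C$ on $R$; if $(x)$ is a minimal reduction of $\mathcal C$, then $\mathrm{cdeg}(R)=\lambda(\mathcal C/(x))$. The bi-canonical degree of $R$ is the integer $\mathrm{bideg}(R)=\lambda(\mathcal C^{**}/\mathcal C)$, where $\mathcal C^{**}=\mathrm{Hom}_R(\mathrm{Hom}_R(\mathcal C,R),R)$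 is the bidual of $\mathcal C$ (and $\mathcal C$ embeds in $\mathcal C^{**}$ canonically). Both integers are independent of the choice of the canonical ideal $\mathcal C$. *)

(* Defs.v *)
From HB Require Import structures.
From mathcomp Require Import all_boot all_order all_algebra.
From mathcomp Require Import boolp classical_sets.

Set Implicit Arguments.
Unset Strict Implicit.
Unset Printing Implicit Defensive.

Import GRing.Theory.

Local Open Scope ring_scope.
Local Open Scope quotient_scope.

Notation ideal R := (submodClosed (R^o : lmodType R)).

Section Modules.
Variable R : comNzRingType.
Implicit Types M N : lmodType R.

Definition submod_of M (S : submodClosed M) : Type := {x : M | x \in S}.

HB.instance Definition _ M (S : submodClosed M) :=
  SubChoice.copy (submod_of S) {x : M | x \in S}.
HB.instance Definition _ M (S : submodClosed M) :=
  [SubChoice_isSubLmodule of submod_of S by <:].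

Section Quotient.
Variables (M : lmodType R) (S : submodClosed M).

(* [submodClosed] also makes sense over semirings and hence does not coerce to
   [zmodClosed], which the library quotient [Quotient.quot] asks for. *)
Definition submod_pred : {pred M} := fun x => x \in S.
Fact submod_zmod_closed : zmod_closed submod_pred.
Proof. exact: GRing.submod_closedB (GRing.submodClosedP S). Qed.
HB.instance Definition _ := GRing.isZmodClosed.Build M submod_pred submod_zmod_closed.

Definition quot_mod : Type := Quotient.quot submod_pred.

HB.instance Definition _ := GRing.Zmodule.on quot_mod.

Definition quot_pi (x : M) : quot_mod := \pi_(Quotient.quot submod_pred) x.

Definition quot_scale (a : R) (x : quot_mod) : quot_mod :=
  quot_pi (a *: repr (x : Quotient.quot submod_pred)).

Fact quot_ind (P : quot_mod -> Prop) : (forall x, P (quot_pi x)) -> forall x, P x.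
Proof. by move=> Ppi x; rewrite -[x](@reprK _ (Quotient.quot submod_pred)); apply: Ppi. Qed.

Fact quot_piD : {morph quot_pi : x y / x + y}.
Proof. exact: (raddfD (\pi_(Quotient.quot submod_pred))). Qed.

Fact quot_pi_scale a x : quot_scale a (quot_pi x) = quot_pi (a *: x).
Proof.
apply/eqP; rewrite /quot_scale /quot_pi -Quotient.idealrBE -scalerBr.
by apply: (@rpredZ _ _ S); rewrite (Quotient.idealrBE submod_pred) reprK.
Qed.

Fact quot_scaleA a b x : quot_scale a (quot_scale b x) = quot_scale (a * b) x.
Proof. by elim/quot_ind: x => x; rewrite !quot_pi_scale scalerA. Qed.

Fact quot_scale1 : left_id 1 quot_scale.
Proof. by elim/quot_ind=> x; rewrite quot_pi_scale scale1r. Qed.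

Fact quot_scaleDr : right_distributive quot_scale +%R.
Proof.
move=> a; elim/quot_ind=> x; elim/quot_ind=> y.
by rewrite -quot_piD !quot_pi_scale scalerDr quot_piD.
Qed.

Fact quot_scaleDl x : {morph quot_scale^~ x : a b / a + b}.
Proof.
by move=> a b /=; elim/quot_ind: x => x; rewrite !quot_pi_scale scalerDl quot_piD.
Qed.

HB.instance Definition _ := GRing.Zmodule_isLmodule.Build R quot_mod
  quot_scaleA quot_scale1 quot_scaleDr quot_scaleDl.

End Quotient.

Definition hom M N : Type := {linear M -> N}.
Definition hom_fun M N (f : hom M N) : M -> N := f : {linear M -> N}.

Section Hom.
Variables M N : lmodType R.
Implicit Types (f g h : hom M N) (a b : R).

HB.instance Definition _ := gen_eqMixin (hom M N).
HB.instance Definition _ := gen_choiceMixin (hom M N).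

Fact homP f g : hom_fun f =1 hom_fun g -> f = g.
Proof.
case: f => f [[f1] [f2]]; case: g => g [[g1] [g2]] /funext/= efg.
case: _ / efg in g1 g2 *.
by rewrite (Prop_irrelevance f1 g1) (Prop_irrelevance f2 g2).
Qed.

Definition hom0 : hom M N := (\0 : {linear M -> N}).
Definition homN f : hom M N := (\- (f : {linear M -> N})).
Definition homD f g : hom M N := ((f : {linear M -> N}) \+ (g : {linear M -> N})).
Definition homZ a f : hom M N := (a \*: (f : {linear M -> N})).

Fact homDA : associative homD.
Proof. by move=> f g h; apply: homP => x; apply: addrA. Qed.
Fact homDC : commutative homD.
Proof. by move=> f g; apply: homP => x; apply: addrC. Qed.
Fact hom0D : left_id hom0 homD.
Proof. by move=> f; apply: homP => x; apply: add0r. Qed.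
Fact homND : left_inverse hom0 homN homD.
Proof. by move=> f; apply: homP => x; apply: addNr. Qed.

HB.instance Definition _ := GRing.isZmodule.Build (hom M N) homDA homDC hom0D homND.

Fact homZA a b f : homZ a (homZ b f) = homZ (a * b) f.
Proof. by apply: homP => x; apply: scalerA. Qed.
Fact hom1Z : left_id 1 homZ.
Proof. by move=> f; apply: homP => x; apply: scale1r. Qed.
Fact homZDr : right_distributive homZ +%R.
Proof. by move=> a f g; apply: homP => x; apply: scalerDr. Qed.
Fact homZDl f : {morph homZ^~ f : a b / a + b}.
Proof. by move=> a b; apply: homP => x; apply: scalerDl. Qed.

HB.instance Definition _ := GRing.Zmodule_isLmodule.Build R (hom M N)
  homZA hom1Z homZDr homZDl.

End Hom.

Section Image.
Variables (M N : lmodType R) (f : {linear M -> N}).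

Definition lin_image : {pred N} := fun y => `[< exists x, f x = y >].

Fact lin_image_closed : submod_closed lin_image.
Proof.
split=> [|a u v]; first by apply/asboolP; exists 0; rewrite raddf0.
move=> /asboolP[x <-] /asboolP[y <-]; apply/asboolP.
by exists (a *: x + y); rewrite linearP.
Qed.

HB.instance Definition _ := GRing.isSubmodClosed.Build R N lin_image lin_image_closed.

Definition coker : lmodType R := quot_mod lin_image.
End Image.

Section Restriction.
Variables (M N : lmodType R) (S : submodClosed M).

Definition hom_restr (f : hom M N) : hom (submod_of S) N :=
  ((f : {linear M -> N}) \o (val : submod_of S -> M)).

Fact hom_restr_linear : linear hom_restr.
Proof. by move=> a f g; apply: homP. Qed.
HB.instance Definition _ := GRing.isLinear.Build R (hom M N) (hom (submod_of S) N)
  *:%R hom_restr hom_restr_linear.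
End Restriction.

Definition dual M : lmodType R := hom M R^o.

Section Bidual.
Variable M : lmodType R.

Section Eval.
Variable x : M.
Definition eval_fun (f : dual M) : R^o := hom_fun f x.
Fact eval_fun_linear : linear eval_fun. Proof. by []. Qed.
HB.instance Definition _ :=
  GRing.isLinear.Build R (dual M) R^o *:%R eval_fun eval_fun_linear.
End Eval.

Definition bidual_map (x : M) : dual (dual M) := (eval_fun x : {linear dual M -> R^o}).

Fact bidual_map_linear : linear bidual_map.
Proof. by move=> a x y; apply: homP => f; apply: (linearP (f : {linear M -> R^o})). Qed.
HB.instance Definition _ :=
  GRing.isLinear.Build R M (dual (dual M)) *:%R bidual_map bidual_map_linear.
End Bidual.

(* Strict inclusions [S 0 < S 1 < ... < S n] of submodules of [M]. *)
Definition submod_chain M (n : nat) (S : nat -> submodClosed M) : Prop :=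
  forall i, (i < n)%N ->
    {subset S i <= S i.+1} /\ (exists2 x, x \in S i.+1 & x \notin S i).

Definition is_length M (n : nat) : Prop :=
  (exists S, @submod_chain M n S) /\
  (forall p S, @submod_chain M p S -> (p <= n)%N).

(* Pitfall: the value is [0] on modules of infinite length. *)
Definition len M : nat := xget 0%N [set n | is_length M n].

Definition is_local (m : ideal R) : Prop :=
  forall x : R, x \in m <-> ~ (exists y, y * x = 1).

Definition finitely_generated M : Prop :=
  exists n (g : 'I_n -> M), forall x, exists c : 'I_n -> R, x = \sum_i c i *: g i.

Definition injective_module (E : lmodType R) : Prop :=
  forall (A B : lmodType R) (i : {linear A -> B}) (f : {linear A -> E}),
    injective i -> exists g : {linear B -> E}, forall x, g (i x) = f x.

(* There is an exact sequence [0 -> M -> E 0 -> E 1 -> ... -> E n -> 0] with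
   all [E i] injective. *)
Definition finite_injective_dimension M : Prop :=
  exists (n : nat) (E : nat -> lmodType R) (e : {linear M -> E 0%N})
         (d : forall i, {linear E i -> E i.+1}),
    [/\ forall i, injective_module (E i),
        forall i, (n < i)%N -> forall x : E i, x = 0,
        injective e,
        forall y, d 0%N y = 0 <-> (exists x, e x = y)
      & forall i y, d i.+1 y = 0 <-> (exists x, d i x = y)].

(* [Ext^1(R/m, M)], computed from [0 -> m -> R -> R/m -> 0]: as [R] is
   projective, it is the cokernel of [Hom(R, M) -> Hom(m, M)]. *)
Definition ext1_residue (m : ideal R) M : lmodType R := coker (@hom_restr R^o M m).

(* A canonical module is a maximal Cohen-Macaulay module of type 1 and of
   finite injective dimension. Over a one-dimensional local ring, a nonzero
   finitely generated module is maximal Cohen-Macaulay iff some element of the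
   maximal ideal is regular on it; its type is then the dimension of
   [Ext^1(R/m, M)] over [R/m], which is the length of this [R]-module. *)
Definition canonical_module (m : ideal R) M : Prop :=
  [/\ finitely_generated M,
      exists x : M, x != 0,
      exists2 x : R, x \in m & injective (fun u : M => x *: u),
      is_length (ext1_residue m M) 1
    & finite_injective_dimension M].

(* A proper ideal whose radical is the maximal ideal [m] is [m]-primary. *)
Definition primary_to (m : ideal R) (I : ideal R) : Prop :=
  {subset I <= m} /\ (forall x : R, x \in m -> exists n, (x ^+ n : R) \in I).

Definition canonical_ideal (m C : ideal R) : Prop :=
  primary_to m C /\ canonical_module m (submod_of C).

Section IdealProduct.
Variables I J : ideal R.

Definition ideal_mul : {pred R^o} := fun x =>
  `[< exists n (f g : 'I_n -> R),
        (forall i, f i \in I /\ g i \in J) /\ x = \sum_i f i * g i >].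

Fact ideal_mul_closed : submod_closed ideal_mul.
Proof.
split=> [|a u v].
  by apply/asboolP; exists 0%N, (fun=> 0), (fun=> 0); split=> [[]|]; rewrite ?big_ord0.
move=> /asboolP[n [f [g [fg ->]]]] /asboolP[p [h [q [hq ->]]]]; apply/asboolP.
pose F i := match split i with inl j => a * f j | inr j => h j end.
pose G i := match split i with inl j => g j | inr j => q j end.
exists (n + p)%N, F, G; split=> [i|].
  rewrite /F /G; case: split => j; last exact: hq.
  by have [fI gJ] := fg j; split=> //; apply: (@rpredZ _ _ I).
rewrite big_split_ord /F /G /= scaler_sumr; congr (_ + _); apply: eq_bigr => i _.
  by rewrite (unsplitK (inl i)) -mulrA.
by rewrite (unsplitK (inr i)).
Qed.

HB.instance Definition _ :=
  GRing.isSubmodClosed.Build R R^o ideal_mul ideal_mul_closed.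
End IdealProduct.

Definition whole_ring : {pred R^o} := predT.
Fact whole_ring_closed : submod_closed whole_ring. Proof. by []. Qed.
HB.instance Definition _ :=
  GRing.isSubmodClosed.Build R R^o whole_ring whole_ring_closed.

Fixpoint ideal_pow (I : ideal R) (n : nat) : ideal R :=
  if n is n'.+1 then ideal_mul I (ideal_pow I n') else whole_ring.

(* Hilbert-Samuel multiplicity of an [m]-primary ideal of a one-dimensional
   local ring: [len (R/I^n) = e0 * n - e1] for all large [n]. *)
Definition is_multiplicity (I : ideal R) (e0 : nat) : Prop :=
  exists (e1 : int) (n0 : nat), forall n, (n0 <= n)%N ->
    (len (quot_mod (ideal_pow I n)))%:Z = e0%:Z * n%:Z - e1.

Definition multiplicity (I : ideal R) : nat := xget 0%N [set e | is_multiplicity I e].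

Definition cdeg (C : ideal R) : int := (multiplicity C)%:Z - (len (quot_mod C))%:Z.

Definition bideg (C : ideal R) : nat := len (coker (@bidual_map (submod_of C))).

End Modules.

Record fps (k : Type) := Fps { fps_coef : nat -> k }.

Section PowerSeries.
Variable k : comNzRingType.
Implicit Types f g h : fps k.

HB.instance Definition _ := gen_eqMixin (fps k).
HB.instance Definition _ := gen_choiceMixin (fps k).

Definition fps0 : fps k := Fps (fun=> 0).
Definition fps1 : fps k := Fps (fun n => (n == 0%N)%:R).
Definition fpsN f : fps k := Fps (fun n => - fps_coef f n).
Definition fpsD f g : fps k := Fps (fun n => fps_coef f n + fps_coef g n).
Definition fpsM f g : fps k :=
  Fps (fun n => \sum_(i < n.+1) fps_coef f i * fps_coef g (n - i)%N).

Fact fpsP f g : fps_coef f =1 fps_coef g -> f = g.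
Proof. by case: f g => f [g] /= /funext->. Qed.

Fact fpsDA : associative fpsD.
Proof. by move=> f g h; apply: fpsP => n /=; rewrite addrA. Qed.
Fact fpsDC : commutative fpsD.
Proof. by move=> f g; apply: fpsP => n /=; rewrite addrC. Qed.
Fact fps0D : left_id fps0 fpsD.
Proof. by move=> f; apply: fpsP => n /=; rewrite add0r. Qed.
Fact fpsND : left_inverse fps0 fpsN fpsD.
Proof. by move=> f; apply: fpsP => n /=; rewrite addNr. Qed.

HB.instance Definition _ := GRing.isZmodule.Build (fps k) fpsDA fpsDC fps0D fpsND.

Definition fps_trunc (n : nat) f : {poly k} := \poly_(i < n.+1) fps_coef f i.

Fact fps_coefM f g n i : (i <= n)%N ->
  fps_coef (fpsM f g) i = (fps_trunc n f * fps_trunc n g)`_i.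
Proof.
move=> le_in; rewrite coefM; apply: eq_bigr => j _.
have le_ji : (j <= i)%N by rewrite -ltnS.
rewrite !coef_poly !ltnS (leq_trans le_ji) //.
by rewrite (leq_trans (leq_subr _ _)).
Qed.

Fact fps_truncMl f g (q : {poly k}) n :
  (fps_trunc n (fpsM f g) * q)`_n = (fps_trunc n f * fps_trunc n g * q)`_n.
Proof.
rewrite !coefM; apply: eq_bigr => i _; congr (_ * _).
have le_in : (i <= n)%N by rewrite -ltnS.
by rewrite coef_poly ltnS le_in (fps_coefM _ _ le_in).
Qed.

Fact fpsMC : commutative fpsM.
Proof. by move=> f g; apply: fpsP => n; rewrite !(fps_coefM _ _ (leqnn n)) mulrC. Qed.

Fact fpsMA : associative fpsM.
Proof.
move=> f g h; apply: fpsP => n; rewrite !(fps_coefM _ _ (leqnn n)) fps_truncMl.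
by rewrite mulrC fps_truncMl mulrC mulrA.
Qed.

Fact fps1M : left_id fps1 fpsM.
Proof.
move=> f; apply: fpsP => n /=; rewrite big_ord_recl /= mul1r subn0 big1 ?addr0 //.
by move=> i _; rewrite mul0r.
Qed.

Fact fpsMDl : left_distributive fpsM fpsD.
Proof.
move=> f g h; apply: fpsP => n /=; rewrite -big_split /=.
by apply: eq_bigr => i _; rewrite mulrDl.
Qed.

Fact fps1_neq0 : fps1 != fps0.
Proof.
by apply/eqP => /(congr1 (fun f => fps_coef f 0%N)) /= /eqP; rewrite oner_eq0.
Qed.

HB.instance Definition _ := GRing.Zmodule_isComNzRing.Build (fps k)
  fpsMA fpsMC fps1M fpsMDl fps1_neq0.
End PowerSeries.

Section SemigroupRing.
Variables (k : fieldType) (a b c : nat).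

(* The image of [F = \sum F i j l X^i Y^j Z^l] in [k[[X,Y,Z]]] under [X |-> t^a],
   [Y |-> t^b], [Z |-> t^c]. For [a, b, c > 0], all [i, j, l] with
   [a * i + b * j + c * l = n] are at most [n]. *)
Definition fps_subst (F : nat -> nat -> nat -> k) : fps k :=
  Fps (fun n => \sum_(i < n.+1) \sum_(j < n.+1)
                  \sum_(l < n.+1 | (a * i + b * j + c * l == n)%N) F i j l).

Definition semigroup_ring_pred : {pred fps k} :=
  fun f => `[< exists F, fps_subst F = f >].

Definition semigroup_mem (n : nat) : bool :=
  [exists i : 'I_n.+1, exists j : 'I_n.+1, exists l : 'I_n.+1,
     (a * i + b * j + c * l == n)%N].

Fact semigroup_ring_predP f :
  reflect (forall n, fps_coef f n != 0 -> semigroup_mem n)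
    (f \in semigroup_ring_pred).
Proof.
apply: (iffP (asboolP _)) => [[F <-] n /= |suppf].
  apply: contraNT => /existsPn nex; apply/eqP.
  apply: big1 => i _; apply: big1 => j _; apply: big1 => l def_n.
  have /existsPn/(_ j)/existsPn/(_ l) := nex i.
  by rewrite def_n.
pose F i j l : k :=
  let n := (a * i + b * j + c * l)%N in
  if [pick u : 'I_n.+1 * 'I_n.+1 * 'I_n.+1 | (a * u.1.1 + b * u.1.2 + c * u.2 == n)%N]
  is Some u then if (u.1.1 == i :> nat) && (u.1.2 == j :> nat) && (u.2 == l :> nat)
                 then fps_coef f n else 0 else 0.
exists F; apply: fpsP => n /=.
rewrite pair_bigA pair_big_dep /=.
under eq_bigr => u /eqP def_n do rewrite /F def_n.
case: pickP => [u def_n | no_u]; last first.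
  rewrite big1 //; apply/esym/eqP; apply: contraTT isT => /suppf.
  by move=> /existsP[i /existsP[j /existsP[l H]]]; have := no_u (i, j, l); rewrite /= H.
case: u def_n => [[u1 u2] u3] /= def_n.
rewrite (bigD1 (u1, u2, u3)) //= !eqxx /= big1 ?addr0 //.
move=> [[i j] l] /= /andP[_ neq_u]; case: ifP => // eq_u.
case/andP: eq_u => /andP[/eqP/val_inj e1 /eqP/val_inj e2] /eqP/val_inj e3.
by rewrite e1 e2 e3 eqxx in neq_u.
Qed.

Lemma semigroup_memP n :
  reflect (exists i j l, n = a * i + b * j + c * l)%N (semigroup_mem n).
Proof.
apply: (iffP existsP) => [[i /existsP[j /existsP[l /eqP<-]]]|[i [j [l ->]]]].
  by exists i, j, l.
have bnd d x y : (d * x <= y)%N -> exists2 z, (z <= y)%N & (d * z = d * x)%N.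
  case: (posnP d) => [-> _|d_gt0 le_dx]; first by exists 0%N.
  by exists x => //; apply: leq_trans le_dx; rewrite leq_pmull.
set n' := (_ + _)%N.
have [|i' hi ei] := bnd a i n'; first by rewrite /n' -addnA leq_addr.
have [|j' hj ej] := bnd b j n'; first by rewrite /n' addnAC leq_addl.
have [|l' hl el] := bnd c l n'; first by rewrite /n' leq_addl.
exists (Ordinal (hi : (i' < n'.+1)%N)); apply/existsP.
exists (Ordinal (hj : (j' < n'.+1)%N)); apply/existsP.
by exists (Ordinal (hl : (l' < n'.+1)%N)); rewrite /= ei ej el.
Qed.

Fact semigroup_ring_closed : subring_closed semigroup_ring_pred.
Proof.
split.
- apply/semigroup_ring_predP => -[|n]; last by rewrite eqxx.
  by move=> _; apply/semigroup_memP; exists 0%N, 0%N, 0%N; rewrite !muln0.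
- move=> f g /semigroup_ring_predP Sf /semigroup_ring_predP Sg.
  apply/semigroup_ring_predP => n; have [/Sf //|/negPn/eqP] := boolP (fps_coef f n != 0).
  have [/Sg //|/negPn/eqP] := boolP (fps_coef g n != 0).
  by move=> /= -> ->; rewrite subr0 eqxx.
- move=> f g /semigroup_ring_predP Sf /semigroup_ring_predP Sg.
  apply/semigroup_ring_predP => n; apply: contraNT => nSn; apply/eqP.
  apply: big1 => i _; apply/eqP; apply: contraNT nSn; rewrite mulf_eq0 negb_or.
  move=> /andP[/Sf/semigroup_memP[x [y [z ei]]] /Sg/semigroup_memP[x' [y' [z' eni]]]].
  apply/semigroup_memP; exists (x + x')%N, (y + y')%N, (z + z')%N.
  have le_in : (i <= n)%N by rewrite -ltnS.
  rewrite -(subnKC le_in) eni {1}ei !mulnDr.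
  by rewrite addnACA (addnACA (a * x)%N).
Qed.

HB.instance Definition _ :=
  GRing.isSubringClosed.Build (fps k) semigroup_ring_pred semigroup_ring_closed.

Definition semigroup_ring : Type := {f : fps k | f \in semigroup_ring_pred}.

HB.instance Definition _ :=
  SubChoice.copy semigroup_ring {f : fps k | f \in semigroup_ring_pred}.
HB.instance Definition _ := [SubChoice_isSubComNzRing of semigroup_ring by <:].

End SemigroupRing.

(* Main.v *)
From HB Require Import structures.
Require Import Defs.
From mathcomp Require Import all_boot all_order all_algebra.
From mathcomp Require Import boolp classical_sets.
From mathcomp Require Import zify ring.

Set Implicit Arguments.
Unset Strict Implicit.
Unset Printing Implicit Defensive.

Import GRing.Theory.

(** Put R = k[[H]], where H is the semigroup of a, b, c, and let C be a
    canonical ideal, x an element of C of least order, so that (x) is a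
    reduction of C.  Everything rests on two facts about types.

    The type of R is at most 2: a numerical semigroup with three generators
    has at most two pseudo-Frobenius numbers ([at_most_two_pf],
    [pseudo_frobenius_le2]).  Hence any s-step chain of ideals changes the colon
    into (x) by length at most 2 s ([dim_socle], [codim_colon]).

    The type of C is 1, which is what the condition on Ext^1 says
    ([ext1_dependent], [socle_dim_le1]).  Hence I |-> (xC : I) does not increase
    relative lengths, and comparing the two ends of a chain from (x) to R, where
    the lengths agree, gives (xC : C) = (x) ([colon_dilate_self]).  The same
    inequality then bounds the number of generators of C by the type of R
    ([codim_max_mul]), so C = (x, y) for some y ([two_generated]).

    Now let A = ((x) : C) and B = ((x) : A).  The map h |-> h y identifies R / A
    with C / (x), so both have the same length d; as R has type at most 2, B / (x)
    has length at most 2 d, and B / C has length at most d ([codim_bidual]).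
    Evaluation at the inclusion of C in R embeds the bidual of C in B compatibly
    with C ([bidual_eval_inj], [bidual_eval_image], [bidual_eval_colon]), whence
    bideg <= d.  On the other hand the multiplicity of C is the order of x
    ([multiplicity_min_ord]), which is the length of R / (x), so d is the
    canonical degree.

    Lengths are computed from orders.  For a nonzero R-submodule I of k[[t]],
    [codim I] is the number of naturals that are not the order of an element of
    I; it is the dimension of k[[t]] / I, and the length of J / I is
    [codim I - codim J].  All ideals are therefore transported to sets of power
    series, where colons, sums and dilations are elementary. *)

(** * Pseudo-Frobenius numbers of a three-generated semigroup *)

Section PseudoFrobenius.
Variables a b c M : nat.

(** Pseudo-Frobenius numbers may be negative (-1, when 1 is in the semigroup), so
    they are shifted by M to stay among the natural numbers. *)
Definition shifted_mem n := exists i j l, n = M + (a * i + b * j + c * l).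

Definition shifted_pf n :=
  [/\ ~ shifted_mem n, shifted_mem (n + a), shifted_mem (n + b)
    & shifted_mem (n + c)].

(** A multiple of a in n + a would put n itself in the semigroup. *)
Lemma shifted_pf_rep p : shifted_pf p ->
  exists x y, p + a = M + (b * x + c * y).
Proof.
move=> [np [[|i] [j [l e]]] _ _]; first by exists j, l; lia.
by case: np; exists i, j, l; lia.
Qed.

(** Otherwise q - p would be a nonzero element of the semigroup, and p plus any
    such element lies in the semigroup while q does not. *)
Lemma shifted_pf_incomparable p q x y x' y' : shifted_pf p -> shifted_pf q ->
  p <> q -> p + a = M + (b * x + c * y) -> q + a = M + (b * x' + c * y') ->
  x <= x' -> y' < y.
Proof.
move=> [np _ [ib [jb [lb eb]]] [ic [jc [lc ec]]]] [nq _ _ _] neq ep eq' lex.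
rewrite ltnNge; apply/negP => ley; apply: nq.
have [dx ex] : exists d, x' = x + d by exists (x' - x); lia.
have [dy ey] : exists d, y' = y + d by exists (y' - y); lia.
case: dx ex => [|dx] ex; last by exists ib, (jb + dx), (lb + dy); lia.
case: dy ey => [|dy] ey; last by exists ic, jc, (lc + dy); lia.
by case: neq; lia.
Qed.

(** Picture the points (x, y) such that M + b x + c y - a is not in the shifted
    semigroup: they form a staircase, and every representation of a
    pseudo-Frobenius number is a corner of it.  Stepping from the middle corner
    (x2, y2) in either direction leaves the staircase through a relation that
    involves a; these two relations either put p2 in the shifted
    semigroup, or have the same coefficient of a.  In the latter
    case they yield b u = c w, along which (x1, y1) slides until it is comparable
    with (x2, y2). *)
Lemma no_middle_pf p1 p2 p3 x1 y1 x2 y2 x3 y3 :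
  shifted_pf p1 -> shifted_pf p2 -> shifted_pf p3 -> p1 <> p2 ->
  p1 + a = M + (b * x1 + c * y1) -> p2 + a = M + (b * x2 + c * y2) ->
  p3 + a = M + (b * x3 + c * y3) -> x1 < x2 -> x2 < x3 -> y2 < y1 -> False.
Proof.
move=> pf1 pf2 pf3 ne12 e1 e2 e3 lt12 lt23 lty.
have [n1 _ _ _] := pf1; have [n2 _ [i [j [l eb]]] [i' [j' [l' ec]]]] := pf2.
have [n3 _ _ _] := pf3.
case: j eb => [|j] eb; last by apply: n2; exists i, j, l; lia.
case: l' ec => [|l'] ec; last by apply: n2; exists i', j', l'; lia.
have [le_yl|lt_ly] := leqP y2 l.
  have [d ed] : exists d, l = y2 + d by exists (l - y2); lia.
  have [z ez] : exists z, x3 = x2 + 1 + z by exists (x3 - x2 - 1); lia.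
  by apply: n3; exists i, z, (d + y3); rewrite ed ez in eb e3; lia.
have [le_xj|lt_jx] := leqP x2 j'.
  have [d ed] : exists d, j' = x2 + d by exists (j' - x2); lia.
  have [z ez] : exists z, y1 = y2 + 1 + z by exists (y1 - y2 - 1); lia.
  by apply: n1; exists i', (d + x1), z; rewrite ed ez in ec e1; lia.
have [g eg] : exists g, y2 = l + 1 + g by exists (y2 - l - 1); lia.
have [h eh] : exists h, x2 = j' + 1 + h by exists (x2 - j' - 1); lia.
have [lt_i|lt_i|ei] := ltngtP i i'.
- have [d ed] : exists d, i' = i + 1 + d by exists (i' - i - 1); lia.
  by apply: n2; exists d, (x2 + j' + 1), g; rewrite eg eh ed in e2 eb ec *; lia.
- have [d ed] : exists d, i = i' + 1 + d by exists (i - i' - 1); lia.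
  by apply: n2; exists d, h, (y2 + l + 1); rewrite eg eh ed in e2 eb ec *; lia.
(* The relation b u = c w, with u = j' + 1 and w = l + 1. *)
have ebc : b * (j' + 1) = c * (l + 1) by rewrite ei eg eh in e2 eb ec *; lia.
have lt12' := ltnW lt12; move: lt12' lty e1 {lt12}.
have [n] := ubnP y1; elim: n x1 y1 => // n IHn x1 y1 lt_n le12 lty e1.
have lt1h : x1 <= h.
  rewrite leqNgt; apply/negP => lthx.
  have [d ed] : exists d, x1 = h + 1 + d by exists (x1 - h - 1); lia.
  have [z ez] : exists z, y1 = y2 + 1 + z by exists (y1 - y2 - 1); lia.
  by apply: n1; exists i', d, z; rewrite eg eh ed ez in e1 e2 eb ec *; lia.
have [z ez] : exists z, y1 = l + 1 + z by exists (y1 - l - 1); lia.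
have e1' : p1 + a = M + (b * (x1 + (j' + 1)) + c * z).
  by rewrite ez in e1; lia.
have le1 : x1 + (j' + 1) <= x2 by lia.
have ltz := shifted_pf_incomparable pf1 pf2 ne12 e1' e2 le1.
by apply: (IHn _ _ _ le1 ltz e1'); lia.
Qed.

Lemma at_most_two_pf p q r : shifted_pf p -> shifted_pf q -> shifted_pf r ->
  [\/ p = q, q = r | p = r].
Proof.
move=> pf1 pf2 pf3.
have [x1 [y1 e1]] := shifted_pf_rep pf1.
have [x2 [y2 e2]] := shifted_pf_rep pf2.
have [x3 [y3 e3]] := shifted_pf_rep pf3.
have [->|/eqP n12] := eqVneq p q; first by constructor 1.
have [->|/eqP n23] := eqVneq q r; first by constructor 2.
have [->|/eqP n13] := eqVneq p r; first by constructor 3.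
have n21 := nesym n12; have n32 := nesym n23; have n31 := nesym n13.
have C := shifted_pf_incomparable.
have c12 := C _ _ _ _ _ _ pf1 pf2 n12 e1 e2.
have c21 := C _ _ _ _ _ _ pf2 pf1 n21 e2 e1.
have c13 := C _ _ _ _ _ _ pf1 pf3 n13 e1 e3.
have c31 := C _ _ _ _ _ _ pf3 pf1 n31 e3 e1.
have c23 := C _ _ _ _ _ _ pf2 pf3 n23 e2 e3.
have c32 := C _ _ _ _ _ _ pf3 pf2 n32 e3 e2.
have N := no_middle_pf.
have := N _ _ _ _ _ _ _ _ _ pf1 pf2 pf3 n12 e1 e2 e3.
have := N _ _ _ _ _ _ _ _ _ pf1 pf3 pf2 n13 e1 e3 e2.
have := N _ _ _ _ _ _ _ _ _ pf2 pf1 pf3 n21 e2 e1 e3.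
have := N _ _ _ _ _ _ _ _ _ pf2 pf3 pf1 n23 e2 e3 e1.
have := N _ _ _ _ _ _ _ _ _ pf3 pf1 pf2 n31 e3 e1 e2.
have := N _ _ _ _ _ _ _ _ _ pf3 pf2 pf1 n32 e3 e2 e1.
clear -c12 c21 c13 c31 c23 c32; lia.
Qed.

End PseudoFrobenius.

Section Conductor.
Variables a b c : nat.
Hypotheses (a_gt0 : 0 < a) (b_gt0 : 0 < b) (abc1 : gcdn (gcdn a b) c = 1).
Let mem := semigroup_mem a b c.

Lemma semigroup_memD m n : mem m -> mem n -> mem (m + n).
Proof.
move=> /semigroup_memP[x [y [z ->]]] /semigroup_memP[x' [y' [z' ->]]].
by apply/semigroup_memP; exists (x + x'), (y + y'), (z + z'); lia.
Qed.

(** Bezout gives consecutive elements n and n + 1 of the semigroup; writing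
    m = q n + r with r < n <= q, one has m = (q - r) n + r (n + 1). *)
Lemma semigroup_conductor : exists N, forall n, N <= n -> mem n.
Proof.
have [u _ /dvdnP[v euv]] := Bezoutl b a_gt0.
have g_gt0 : 0 < gcdn a b by rewrite gcdn_gt0 a_gt0.
have [s _ /dvdnP[t est]] := Bezoutl c g_gt0.
rewrite abc1 in est.
have [n [memn memSn]] : exists n, mem n /\ mem n.+1.
  exists (s * c + t * (u * b)); split; apply/semigroup_memP.
    by exists 0, (t * u), s; lia.
  by exists (t * v), 0, 0; rewrite -mulnCA; nia.
have memM j m : mem m -> mem (m * j).
  move=> memm; elim: j => [|j IHj]; last by rewrite mulnS semigroup_memD.
  by rewrite muln0; apply/semigroup_memP; exists 0, 0, 0; lia.
exists (n * n) => m le_m.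
have [n0|n_gt0] := posnP n; first by rewrite -(mul1n m) memM // -n0.
have -> : m = n * (m %/ n - m %% n) + n.+1 * (m %% n).
  have : m %% n <= m %/ n.
    by rewrite ltnW // (leq_trans (ltn_pmod m n_gt0)) // leq_divRL.
  by have := divn_eq m n; nia.
by rewrite semigroup_memD ?memM.
Qed.
End Conductor.

Local Open Scope ring_scope.

(** * Orders and division of power series *)

Section PowerSeries.
Variable k : fieldType.
Implicit Types f g h : fps k.

Lemma fps_coef0 n : fps_coef (0 : fps k) n = 0. Proof. by []. Qed.
Lemma fps_coef1 n : fps_coef (1 : fps k) n = (n == 0%N)%:R. Proof. by []. Qed.
Lemma fps_coefD f g n : fps_coef (f + g) n = fps_coef f n + fps_coef g n.
Proof. by []. Qed.
Lemma fps_coefN f n : fps_coef (- f) n = - fps_coef f n. Proof. by []. Qed.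
Lemma fps_coefB f g n : fps_coef (f - g) n = fps_coef f n - fps_coef g n.
Proof. by []. Qed.
Lemma fps_coef_mul f g n :
  fps_coef (f * g) n = \sum_(i < n.+1) fps_coef f i * fps_coef g (n - i)%N.
Proof. by []. Qed.
Lemma fps_coef_sum I (r : seq I) (P : pred I) (F : I -> fps k) n :
  fps_coef (\sum_(i <- r | P i) F i) n = \sum_(i <- r | P i) fps_coef (F i) n.
Proof. exact: (big_morph (fun f => fps_coef f n)). Qed.

Definition fps_const (x : k) : fps k := Fps (fun n => if n == 0%N then x else 0).
Definition fps_mono (m : nat) : fps k := Fps (fun n => (n == m)%:R).

Lemma fps_coef_const x f n : fps_coef (fps_const x * f) n = x * fps_coef f n.
Proof.
rewrite fps_coef_mul big_ord_recl /= subn0 big1 ?addr0 // => i _.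
by rewrite mul0r.
Qed.

Lemma fps_coef_mono m f n :
  fps_coef (fps_mono m * f) n = if (m <= n)%N then fps_coef f (n - m) else 0.
Proof.
rewrite fps_coef_mul; case: leqP => [le_mn|lt_nm].
  rewrite (bigD1 (Ordinal (le_mn : m < n.+1)%N)) //= eqxx mul1r.
  rewrite big1 ?addr0 // => i neq_i.
  by rewrite -val_eqE /= in neq_i; rewrite (negPf neq_i) mul0r.
rewrite big1 // => i _; rewrite [fps_coef _ _]/=.
by rewrite (ltn_eqF (leq_trans _ lt_nm)) ?mul0r //.
Qed.

Definition has_ord f n :=
  fps_coef f n != 0 /\ forall i, (i < n)%N -> fps_coef f i = 0.

Lemma has_ord_exists f : f != 0 -> exists n, has_ord f n.
Proof.
move=> f0; have nz : exists n, fps_coef f n != 0.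
  apply: contrapT => nex; case/eqP: f0; apply: fpsP => n; apply/eqP/negPn/negP.
  by move=> fn; apply: nex; exists n.
exists (ex_minn nz); case: ex_minnP => n fn minn; split=> // i lt_in.
by apply/eqP; apply: contraLR lt_in; rewrite -leqNgt; apply: minn.
Qed.

Lemma has_ord_neq0 f n : has_ord f n -> f != 0.
Proof. by case=> fn _; apply: contraNneq fn => ->. Qed.

Lemma has_ord_unique f m n : has_ord f m -> has_ord f n -> m = n.
Proof.
move=> [fm f0m] [fn f0n]; case: (ltngtP m n) => // [/f0n e|/f0m e].
  by rewrite e eqxx in fm.
by rewrite e eqxx in fn.
Qed.

Lemma mul_vanish f g n m : (forall i, (i < n)%N -> fps_coef f i = 0) ->
  (forall i, (i < m)%N -> fps_coef g i = 0) ->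
  (forall i, (i < n + m)%N -> fps_coef (f * g) i = 0) /\
  fps_coef (f * g) (n + m)%N = fps_coef f n * fps_coef g m.
Proof.
move=> f0 g0; split=> [i lt_i|].
  rewrite fps_coef_mul big1 // => j _; have [/f0->|le_nj] := ltnP j n.
    by rewrite mul0r.
  by rewrite (g0 (i - j)%N) ?mulr0 //; have := ltn_ord j; lia.
rewrite fps_coef_mul.
rewrite (bigD1 (Ordinal (leq_addr m n : n < (n + m).+1)%N)) //= addKn.
rewrite big1 ?addr0 // => j; rewrite -val_eqE /= => /eqP neq_j.
have [/f0->|le_nj] := ltnP j n; first by rewrite mul0r.
by rewrite (g0 (n + m - j)%N) ?mulr0 //; have := ltn_ord j; lia.
Qed.

Lemma has_ordM f g n m : has_ord f n -> has_ord g m -> has_ord (f * g) (n + m).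
Proof.
move=> [fn f0] [gm g0]; have [v e] := mul_vanish f0 g0.
by split=> //; rewrite e mulf_neq0.
Qed.

Lemma fps_mulf_eq0 f g : f * g = 0 -> f = 0 \/ g = 0.
Proof.
move=> fg0; have [->|/has_ord_exists[n fn]] := eqVneq f 0; first by left.
have [->|/has_ord_exists[m gm]] := eqVneq g 0; first by right.
by have := has_ord_neq0 (has_ordM fn gm); rewrite fg0 eqxx.
Qed.

Lemma fps_mulfI f : f != 0 -> injective ( *%R f).
Proof.
move=> f0 g h /eqP; rewrite -subr_eq0 -mulrBr => /eqP/fps_mulf_eq0[e|/eqP].
  by rewrite e eqxx in f0.
by rewrite subr_eq0 => /eqP.
Qed.

Lemma has_ord_mono m : has_ord (fps_mono m) m.
Proof.
by split=> [|i lt_i] /=; rewrite ?eqxx ?oner_eq0 // (ltn_eqF lt_i).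
Qed.

(** The list of the first j coefficients of h / f, where n is the order of f. *)
Fixpoint div_seq f n h (j : nat) : seq k :=
  if j is j'.+1 then
    let s := div_seq f n h j' in
    rcons s ((fps_coef h (n + j') - \sum_(i < j') s`_i * fps_coef f (n + j' - i))
             / fps_coef f n)
  else [::].

Lemma size_div_seq f n h j : size (div_seq f n h j) = j.
Proof. by elim: j => //= j IHj; rewrite size_rcons IHj. Qed.

Lemma nth_div_seq f n h i j : (i < j)%N ->
  (div_seq f n h j)`_i = (div_seq f n h i.+1)`_i.
Proof.
elim: j => // j IHj; rewrite ltnS leq_eqVlt => /orP[/eqP->//|lt_ij].
by rewrite [div_seq _ _ _ j.+1]/= nth_rcons size_div_seq lt_ij IHj.
Qed.

Lemma fps_div f n h : has_ord f n -> (forall i, (i < n)%N -> fps_coef h i = 0) ->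
  exists q, h = f * q.
Proof.
move=> [fn f0] h0.
have [q qE] : exists q, forall j, fps_coef q j * fps_coef f n =
    fps_coef h (n + j) - \sum_(i < j) fps_coef q i * fps_coef f (n + j - i).
  exists (Fps (fun j => (div_seq f n h j.+1)`_j)) => j.
  rewrite /= nth_rcons size_div_seq ltnn eqxx divfK //; congr (_ - _).
  by apply: eq_bigr => i _; rewrite nth_div_seq.
exists q; apply: fpsP => m; rewrite mulrC fps_coef_mul.
have [lt_mn|le_nm] := ltnP m n.
  rewrite h0 // big1 // => i _; rewrite f0 ?mulr0 //.
  by rewrite (leq_ltn_trans (leq_subr _ _)).
have [j ->] : exists j, m = (n + j)%N by exists (m - n)%N; rewrite subnKC.
rewrite -(big_mkord xpredT (fun i => fps_coef q i * fps_coef f (n + j - i)%N)).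
rewrite (@big_cat_nat _ _ _ j.+1) /= ?ltnS ?leq_addl //.
rewrite [X in _ + X]big_nat_cond [X in _ + X]big1 ?addr0; last first.
  move=> i /andP[/andP[lt_ji le_i] _].
  by rewrite (f0 (n + j - i)%N) ?mulr0 //; lia.
by rewrite big_nat_recr //= addnK qE big_mkord subrKC.
Qed.

Lemma fps_inv f : fps_coef f 0 != 0 -> exists q, f * q = 1.
Proof.
move=> f0; have f_ord : has_ord f 0 by split.
by have [|q e] := @fps_div f 0 1 f_ord; [|exists q].
Qed.

Lemma fps_constN x : fps_const (- x) = - fps_const x.
Proof. by apply: fpsP => -[|n]; rewrite fps_coefN //= oppr0. Qed.
Lemma fps_const0 : fps_const 0 = 0.
Proof. by apply: fpsP => -[|n]. Qed.
Lemma fps_const1 : fps_const 1 = 1.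
Proof. by apply: fpsP => -[|n]. Qed.
Lemma fps_mono_divides m f :
  (forall i, (i < m)%N -> fps_coef f i = 0) -> exists q, f = fps_mono m * q.
Proof. exact: fps_div (has_ord_mono m). Qed.

End PowerSeries.

Lemma dependent_rows (k : fieldType) s (A : 'M[k]_(s.+1, s)) :
  exists2 u : 'rV[k]_s.+1, u != 0 & u *m A = 0.
Proof.
have : kermx A != 0.
  by rewrite -mxrank_eq0 mxrank_ker -lt0n subn_gt0 ltnS rank_leq_col.
move=> /rowV0Pn[u /sub_kermxP uA u0]; by exists u.
Qed.

(** * Lattices over a numerical semigroup ring *)

Definition numerical_semigroup (H : pred nat) :=
  [/\ H 0%N, forall m n, H m -> H n -> H (m + n)%N
    & exists N, forall n, (N <= n)%N -> H n].

Section Lattices.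
Variables (k : fieldType) (H : pred nat) (HS : numerical_semigroup H).
Let H0 : H 0%N. Proof. by case: HS. Qed.
Let HD : forall m n, H m -> H n -> H (m + n)%N. Proof. by case: HS. Qed.
Let H_cofinite : exists N, forall n, (N <= n)%N -> H n. Proof. by case: HS. Qed.
Implicit Types (f g h u x : fps k) (I J K T W : set (fps k)).
Local Open Scope classical_set_scope.

(** k[[H]] and its maximal ideal, as sets of power series. *)
Definition sring : set (fps k) := [set f | forall n, fps_coef f n != 0 -> H n].
Definition smax : set (fps k) := [set f | sring f /\ fps_coef f 0 = 0].

Definition is_submod I :=
  [/\ I 0, forall f g, I f -> I g -> I (f + g)
    & forall r f, sring r -> I f -> I (r * f)].
Definition is_lattice I := is_submod I /\ exists2 f, I f & f != 0.

Definition adjoin I g : set (fps k) := [set i + r * g | i in I & r in sring].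
Definition colon W I : set (fps k) :=
  [set h | sring h /\ forall u, I u -> W (h * u)].
Definition dilate x I : set (fps k) := [set x * i | i in I].

Lemma sring_const z : sring (fps_const z).
Proof. by case=> [|n] //=; rewrite eqxx. Qed.

Lemma sring_mono n : H n -> sring (fps_mono k n).
Proof. by move=> Hn i /=; have [->//|_] := eqVneq i n; rewrite eqxx. Qed.

Lemma sring1 : sring 1.
Proof. by rewrite -fps_const1; apply: sring_const. Qed.

Lemma sringM f g : sring f -> sring g -> sring (f * g).
Proof.
move=> Rf Rg n; apply: contraNT => nHn; rewrite fps_coef_mul big1 // => i _.
apply/eqP; apply: contraNT nHn; rewrite mulf_eq0 negb_or => /andP[fi gi].
have := HD (Rf _ fi) (Rg _ gi); rewrite subnKC //; exact: ltn_ord i.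
Qed.

Lemma sringD f g : sring f -> sring g -> sring (f + g).
Proof.
move=> Rf Rg n; rewrite fps_coefD => fgn.
have [f0|/Rf//] := eqVneq (fps_coef f n) 0; apply: Rg.
by rewrite f0 add0r in fgn.
Qed.

Lemma sring_submod : is_submod sring.
Proof.
split=> [n||]; [by rewrite fps_coef0 eqxx | exact: sringD | exact: sringM].
Qed.
Hint Resolve sring_submod : core.

Section Submod.
Variables (I : set (fps k)) (I_submod : is_submod I).

Lemma submod0 : I 0. Proof. by case: I_submod. Qed.
Lemma submodD f g : I f -> I g -> I (f + g).
Proof. by case: I_submod => _ /(_ f g). Qed.
Lemma submodM r f : sring r -> I f -> I (r * f).
Proof. by case: I_submod => _ _ /(_ r f). Qed.
Lemma submodZ z f : I f -> I (fps_const z * f).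
Proof. exact/submodM/sring_const. Qed.
Lemma submodN f : I f -> I (- f).
Proof. by move=> If; rewrite -mulN1r -fps_const1 -fps_constN; apply: submodZ. Qed.
Lemma submodB f g : I f -> I g -> I (f - g).
Proof. by move=> If /submodN; apply: submodD. Qed.
Lemma submod_sum n (F : 'I_n -> fps k) : (forall i, I (F i)) -> I (\sum_i F i).
Proof. by move=> IF; elim/big_ind: _ => //; [apply: submod0|apply: submodD]. Qed.
End Submod.

Lemma adjoin_submod I g : is_submod I -> is_submod (adjoin I g).
Proof.
move=> sI; split.
- by exists 0; [apply: submod0|exists 0; rewrite ?mul0r ?addr0 //;
   apply: submod0].
- move=> _ _ [i Ii [r Rr <-]] [j Ij [s Rs <-]].
  exists (i + j); first exact: submodD.
  by exists (r + s); [apply: sringD|rewrite mulrDl addrACA].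
- move=> s _ Rs [i Ii [r Rr <-]]; exists (s * i); first exact: submodM.
  by exists (s * r); [apply: sringM|rewrite mulrDr mulrA].
Qed.

Lemma sub_adjoin I g : I `<=` adjoin I g.
Proof. by move=> i Ii; exists i => //; exists 0; rewrite ?mul0r ?addr0 //;
  apply: submod0. Qed.

Lemma mem_adjoin I g : is_submod I -> adjoin I g g.
Proof.
move=> sI; exists 0; first exact: submod0.
by exists 1; rewrite ?mul1r ?add0r //; apply: sring1.
Qed.

Lemma adjoin_sub I J g : is_submod J -> I `<=` J -> J g -> adjoin I g `<=` J.
Proof.
by move=> sJ IJ Jg _ [i /IJ Ji [r Rr <-]]; apply: submodD => //; apply: submodM.
Qed.

Lemma smaxP r : sring r -> exists z u, smax u /\ r = fps_const z + u.
Proof.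
move=> Rr; exists (fps_coef r 0), (r - fps_const (fps_coef r 0)); split;
  last first.
  by rewrite addrC subrK.
split; last by rewrite fps_coefB /= subrr.
by apply: (submodB sring_submod) => //; apply: sring_const.
Qed.

Lemma adjoin_simple I g f : is_submod I -> (forall u, smax u -> I (u * g)) ->
  adjoin I g f -> exists2 i, I i & exists z, f = i + fps_const z * g.
Proof.
move=> sI mg [i Ii [r /smaxP[z [u [mu ->]]] <-]].
exists (i + u * g); first by apply: submodD => //; apply: mg.
by exists z; rewrite mulrDl (addrC (fps_const z * g)) addrA.
Qed.

Lemma adjoin_lattice I g : is_lattice I -> is_lattice (adjoin I g).
Proof.
move=> [sI [f If f0]]; split; first exact: adjoin_submod.
by exists f => //; apply: sub_adjoin.
Qed.

Lemma sring_lattice : is_lattice sring.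
Proof. by split=> //; exists 1; [apply: sring1|apply: oner_neq0]. Qed.

Lemma colon_submod W I : is_submod W -> is_submod (colon W I).
Proof.
move=> sW; split.
- split; first exact: submod0.
  by move=> u _; rewrite mul0r; apply: submod0.
- move=> f g [Rf If] [Rg Ig]; split; first exact: sringD.
  by move=> u Iu; rewrite mulrDl; apply: submodD; [|apply: If|apply: Ig].
- move=> r f Rr [Rf If]; split; first exact: sringM.
  by move=> u Iu; rewrite -mulrA; apply: submodM => //; apply: If.
Qed.

Lemma colon_lattice W I : is_lattice W -> W `<=` sring -> I `<=` sring ->
  is_lattice (colon W I).
Proof.
move=> [sW [w Ww w0]] WR IR; split; first exact: colon_submod.
exists w => //; split=> [|u Iu]; first exact: WR.
by rewrite mulrC; apply: submodM => //; apply: IR.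
Qed.

Lemma colon_sring W I : colon W I `<=` sring. Proof. by move=> f []. Qed.

Lemma dilate_submod x I : is_submod I -> is_submod (dilate x I).
Proof.
move=> sI; split.
- by exists 0; rewrite ?mulr0 //; apply: submod0.
- by move=> _ _ [i Ii <-] [j Ij <-]; exists (i + j); rewrite ?mulrDr //;
   apply: submodD.
- by move=> r _ Rr [i Ii <-]; exists (r * i); rewrite 1?mulrCA //; apply: submodM.
Qed.

Lemma dilate_lattice x I : x != 0 -> is_lattice I -> is_lattice (dilate x I).
Proof.
move=> x0 [sI [f If f0]]; split; first exact: dilate_submod.
exists (x * f); first by exists f.
by apply/eqP => /fps_mulf_eq0[] /eqP; rewrite (negPf x0, negPf f0).
Qed.

Lemma dilate_sub x I J : is_submod J -> sring x -> I `<=` J -> dilate x I `<=` J.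
Proof. by move=> sJ Rx IJ _ [i /IJ Ji <-]; apply: submodM. Qed.

Definition ords I : pred nat := fun n => `[< exists2 f, I f & has_ord f n >].

Lemma ordsP I n : reflect (exists2 f, I f & has_ord f n) (ords I n).
Proof. exact: asboolP. Qed.

Lemma ordsS I J n : I `<=` J -> ords I n -> ords J n.
Proof. by move=> IJ /ordsP[f /IJ Jf fn]; apply/ordsP; exists f. Qed.

(** With f in I of order n, every series of order at least n plus the conductor is
    a multiple of f by an element of the ring. *)
Lemma lattice_full I : is_lattice I -> exists N, forall f,
  (forall i, (i < N)%N -> fps_coef f i = 0) -> I f.
Proof.
move=> [sI [g Ig /has_ord_exists[n gn]]]; have [N HN] := H_cofinite.
exists (n + N)%N => f f0.
have [|q ef] := fps_div (h := f) gn; first by move=> i lt_i; apply: f0; lia.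
rewrite ef mulrC; apply: submodM => // j qj; apply: HN; rewrite leqNgt.
apply/negP => lt_jN.
have q0 : q != 0 by apply: contraNneq qj => ->.
have [m qm] := has_ord_exists q0.
have le_mj : (m <= j)%N by rewrite leqNgt; apply/negP => /qm.2 e;
  rewrite e eqxx in qj.
have [] := has_ordM gn qm; rewrite -ef f0 ?eqxx //; lia.
Qed.

(** Successive subtraction of scalar multiples of elements of I raises the order
    of f until [lattice_full] applies. *)
Lemma mem_of_ords I J n0 f : is_lattice I -> is_submod J -> I `<=` J ->
  (forall n, (n0 <= n)%N -> ords J n -> ords I n) ->
  J f -> (forall i, (i < n0)%N -> fps_coef f i = 0) -> I f.
Proof.
move=> lI sJ IJ vJI; have [N fullI] := lattice_full lI; have [sI _] := lI.
suff claim d g : J g -> (forall i, (i < n0)%N || (i + d < N)%N ->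
  fps_coef g i = 0) -> I g.
  move=> Jf f0; apply: (claim N) => // i /orP[/f0//|]; lia.
elim: d g => [|d IHd] g Jg g0.
  by apply: fullI => i lt_i; apply: g0; rewrite addn0 lt_i orbT.
have [lt_dN|le_Nd] := ltnP d N; last by apply: IHd => // i lt_i; apply: g0; lia.
pose n := (N - d.+1)%N.
have [gn0|gn] := eqVneq (fps_coef g n) 0.
  apply: IHd => // i lt_i; have [->//|/eqP neq_in] := eqVneq i n.
  by apply: g0; rewrite /n in neq_in; lia.
have g_ord : has_ord g n by split=> // i lt_i; apply: g0; rewrite /n in lt_i; lia.
have [lt_n|le_n] := ltnP n n0; first by rewrite g0 ?lt_n ?eqxx // in gn.
have /ordsP[h Ih [hn h0]] : ords I n by apply: vJI => //; apply/ordsP; exists g.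
pose z := fps_coef g n / fps_coef h n.
rewrite -(subrK (fps_const z * h) g); apply: submodD => //; last exact: submodZ.
apply: IHd => [|i lt_i].
  by apply: submodB => //; apply: submodZ => //; apply: IJ.
rewrite fps_coefB fps_coef_const; have [->|/eqP neq_in] := eqVneq i n.
  by rewrite divfK ?subrr.
have lt_in : (i < n)%N by rewrite /n in neq_in le_n *; lia.
by rewrite h0 // mulr0 subr0 g_ord.2.
Qed.

Lemma ords_bound I : is_lattice I -> exists N, forall n, (N <= n)%N -> ords I n.
Proof.
move=> /lattice_full[N fullI]; exists N => n le_n; apply/ordsP.
exists (fps_mono k n); last exact: has_ord_mono.
by apply: fullI => i lt_i /=; rewrite ltn_eqF //; lia.
Qed.

(** This is independent of N once every n >= N is an order.  [codim] picks such an
    N by choice, and [codimE] allows any other. *)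
Definition codim_below N I := count (predC (ords I)) (iota 0 N).
Definition codim I :=
  codim_below (xget 0%N [set N | forall n, (N <= n)%N -> ords I n]) I.

Lemma codim_below_stable I N N' : (forall n, (N <= n)%N -> ords I n) ->
  (N <= N')%N -> codim_below N' I = codim_below N I.
Proof.
move=> vI le_N; rewrite /codim_below -(subnKC le_N) iotaD count_cat.
rewrite [X in (_ + X)%N](_ : _ = 0%N) ?addn0 //.
apply/eqP; rewrite -leqn0 leqNgt -has_count; apply/hasPn => n /=.
by rewrite mem_iota negbK => /andP[le_n _]; apply: vI.
Qed.

Lemma codimE I N : (forall n, (N <= n)%N -> ords I n) ->
  codim I = codim_below N I.
Proof.
move=> vN; rewrite /codim; set N' := xget _ _.
have vN' : forall n, (N' <= n)%N -> ords I n.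
  by apply: (@xgetPex _ _ [set N | forall n, (N <= n)%N -> ords I n]); exists N.
rewrite -(@codim_below_stable I N (maxn N N')) ?leq_maxl //.
by rewrite -(@codim_below_stable I N' (maxn N N')) ?leq_maxr.
Qed.

Lemma codim_common I J : is_lattice I -> is_lattice J ->
  exists N, [/\ codim I = codim_below N I, codim J = codim_below N J,
    forall n, (N <= n)%N -> ords I n & forall n, (N <= n)%N -> ords J n].
Proof.
move=> /ords_bound[N vI] /ords_bound[N' vJ]; exists (maxn N N').
by split; try apply: codimE; move=> n; rewrite geq_max => /andP[? ?]; auto.
Qed.

Lemma codim_le I J : is_lattice I -> is_lattice J -> I `<=` J ->
  (codim J <= codim I)%N.
Proof.
move=> lI lJ IJ; have [N [-> -> _ _]] := codim_common lI lJ.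
by apply: sub_count => n /=; apply: contra; apply: ordsS.
Qed.

Lemma count_split (P Q : pred nat) s :
  count Q s = (count (predI P Q) s + count (predI (predC P) Q) s)%N.
Proof. by rewrite -!count_filter count_predC size_filter. Qed.

Lemma codim_gaps I J N :
  (codim_below N I <= codim_below N J + count (predD (ords J) (ords I)) (iota 0 N))%N.
Proof.
rewrite /codim_below (count_split (predC (ords J)) (predC (ords I))).
apply: leq_add; apply: sub_count => n /=; first by case/andP.
by rewrite negbK andbC.
Qed.

Lemma codim_gaps_sub I J N : I `<=` J ->
  codim_below N I =
    (codim_below N J + count (predD (ords J) (ords I)) (iota 0 N))%N.
Proof.
move=> IJ; rewrite /codim_below (count_split (predC (ords J)) (predC (ords I))).
congr (_ + _)%N; apply: eq_count => n /=; last by rewrite negbK andbC.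
by rewrite andb_idr //; apply: contra; apply: ordsS.
Qed.

Lemma sub_of_codim I J : is_lattice I -> is_lattice J -> I `<=` J ->
  (codim I <= codim J)%N -> J `<=` I.
Proof.
move=> lI lJ IJ; have [N [-> -> vI _]] := codim_common lI lJ.
rewrite (codim_gaps_sub N IJ) -[leqRHS]addn0 leq_add2l leqn0 => gaps0 f Jf.
have [sI _] := lI; have [sJ _] := lJ.
apply: (@mem_of_ords I J 0%N) => // n _ Jn; have [/vI//|lt_n] := leqP N n.
apply: contraTT gaps0 => nIn; rewrite -lt0n -has_count; apply/hasP.
by exists n => /=; rewrite ?mem_iota ?nIn.
Qed.

Lemma codim_lt I J : is_lattice I -> is_lattice J -> I `<=` J -> ~ (J `<=` I) ->
  (codim J < codim I)%N.
Proof.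
by move=> lI lJ IJ nJI; rewrite ltnNge; apply/negP => /(sub_of_codim lI lJ IJ).
Qed.

(** An element g of J whose order is the largest one missing from I: elements of
    J of larger order all lie in I. *)
Lemma simple_extension I J : is_lattice I -> is_lattice J -> I `<=` J ->
  ~ (J `<=` I) -> exists g, [/\ J g, ~ I g & forall u, smax u -> I (u * g)].
Proof.
move=> lI lJ IJ nJI; have [N vI] := ords_bound lI.
have [sI _] := lI; have [sJ _] := lJ.
have ex : exists n, predD (ords J) (ords I) n.
  apply: contrapT => nex; apply: nJI => f Jf.
  apply: (@mem_of_ords I J 0%N) => // n _ Jn; apply/negPn/negP => nIn.
  by apply: nex; exists n; rewrite /= nIn.
have ub n : predD (ords J) (ords I) n -> (n <= N)%N.
  by move=> /andP[nIn _]; apply: ltnW; rewrite ltnNge; apply/negP => /vI;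
    apply/negP.
case: (ex_maxnP ex ub) => n /andP[nIn /ordsP[g Jg gn]] maxn.
exists g; split=> // [Ig|u [Ru u0]].
  by case/negP: nIn; apply/ordsP; exists g.
apply: (@mem_of_ords I J n.+1) => //; last 2 first.
- exact: submodM.
- move=> i lt_i; have [|v _] := @mul_vanish _ u g 1 n _ gn.2; first by case.
  by apply: v; rewrite add1n.
- move=> p lt_np Jp; apply/negPn/negP => nIp.
  by have := maxn p; rewrite /= nIp Jp => /(_ isT); rewrite leqNgt lt_np.
Qed.

(** Composition series as an induction principle: J is reached from I by steps
    with simple quotient. *)
Lemma lattice_ind I J (P : set (fps k) -> Prop) :
  is_lattice I -> is_lattice J -> I `<=` J -> P I ->
  (forall K g, is_lattice K -> I `<=` K -> K `<=` J -> J g -> ~ K g ->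
     (forall u, smax u -> K (u * g)) -> P K -> P (adjoin K g)) -> P J.
Proof.
move=> lI lJ IJ PI step; have [sJ _] := lJ.
suff claim n K : (codim K < n)%N -> is_lattice K -> I `<=` K -> K `<=` J ->
  P K -> P J.
  by apply: (claim (codim I).+1 I).
elim: n K => // n IHn K lt_n lK IK KJ PK.
have [JK|nJK] := pselect (J `<=` K).
  by have <- : K = J by apply/seteqP.
have [g [Jg nKg mg]] := simple_extension lK lJ KJ nJK; have [sK _] := lK.
apply: (IHn (adjoin K g)).
- rewrite -ltnS; apply: leq_trans lt_n; rewrite ltnS; apply: codim_lt => //;
   first exact: adjoin_lattice.
    exact: sub_adjoin.
  by move=> /(_ g (mem_adjoin _ sK)).
- exact: adjoin_lattice.
- by move=> f /IK; apply: sub_adjoin.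
- exact: adjoin_sub.
- exact: step.
Qed.

(** T' / T has dimension at most s over k, expressed by linear dependence so that
    bounds can be pulled back along multiplications. *)
Definition dim_le s T T' := forall h : 'I_s.+1 -> fps k, (forall i, T' (h i)) ->
  exists2 z : 'I_s.+1 -> k, exists i, z i != 0 & T (\sum_i fps_const (z i) * h i).

(** If T' had s + 1 orders missing from T, elements of T' of these orders would be
    dependent modulo T, and the combination would have one of these orders. *)
Lemma codim_of_dim_le s T T' : is_lattice T -> is_lattice T' -> dim_le s T T' ->
  (codim T <= codim T' + s)%N.
Proof.
move=> lT lT' dimT; have [N [-> -> _ _]] := codim_common lT lT'.
apply: leq_trans (codim_gaps T T' N) _; rewrite leq_add2l leqNgt; apply/negP.
rewrite -size_filter; set r := filter _ _ => lt_s.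
have r_gap i : (i < size r)%N -> predD (ords T') (ords T) (nth 0%N r i).
  by move=> /(mem_nth 0%N); rewrite mem_filter => /andP[].
have uniq_r : uniq r by rewrite filter_uniq ?iota_uniq.
have lt_r (i : 'I_s.+1) : (i < size r)%N by apply: leq_trans lt_s.
have /choice[h hP] (i : 'I_s.+1) : exists f, T' f /\ has_ord f (nth 0%N r i).
  by have /andP[_ /ordsP[f]] := r_gap _ (lt_r i); exists f.
have [z [i0 zi0] Tz] := dimT h (fun i => (hP i).1).
have [i zi min_i] : exists2 i, z i != 0 &
    forall j, z j != 0 -> (nth 0%N r i <= nth 0%N r j)%N.
  pose r_ (i : 'I_s.+1) := nth 0%N r i.
  by case: (@arg_minnP _ i0 [pred i | z i != 0] r_ zi0) => i; exists i.
have /andP[/negP[]] := r_gap _ (lt_r i); apply/ordsP;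
  exists (\sum_i fps_const (z i) * h i) => //.
have coefE n : (n <= (nth 0%N r i))%N ->
    fps_coef (\sum_i fps_const (z i) * h i) n = z i * fps_coef (h i) n.
  move=> le_n; rewrite fps_coef_sum (bigD1 i) // fps_coef_const big1;
    first exact: addr0.
  move=> j neq_j.
  rewrite fps_coef_const; have [->|zj] := eqVneq (z j) 0; first by rewrite mul0r.
  rewrite (hP j).2.2 ?mulr0 //; apply: leq_ltn_trans le_n _;
    rewrite ltn_neqAle min_i // andbT.
  by rewrite nth_uniq // eq_sym.
have [hi0 hi] := (hP i).2.
split=> [|n lt_n]; first by rewrite coefE ?mulf_neq0.
by rewrite coefE ?hi ?mulr0 // ltnW.
Qed.

Lemma dim_le_adjoin I g : is_submod I -> (forall u, smax u -> I (u * g)) ->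
  dim_le 1 I (adjoin I g).
Proof.
move=> sI mg h hI.
have [i Ii [z ez]] := adjoin_simple sI mg (hI ord0).
have [j Ij [w ew]] := adjoin_simple sI mg (hI (lift ord0 ord0)).
pose F (y0 y1 : k) (i : 'I_2) := if i == ord0 then y0 else y1.
have sumF y0 y1 : \sum_(i < 2) fps_const (F y0 y1 i) * h i =
    fps_const y0 * (i + fps_const z * g) + fps_const y1 * (j + fps_const w * g).
  by rewrite big_ord_recl big_ord1 ez ew.
have [z0|z0] := eqVneq z 0.
  exists (F 1 0); first by exists ord0; rewrite /F oner_eq0.
  by rewrite sumF z0 fps_const0 fps_const1 !mul0r mul1r !addr0.
exists (F w (- z)); first by exists (lift ord0 ord0); rewrite /F /= oppr_eq0.
rewrite sumF (_ : _ + _ = fps_const w * i + fps_const (- z) * j).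
  by apply: submodD => //; apply: submodZ.
by rewrite fps_constN; ring.
Qed.

Lemma codim_adjoin I g : is_lattice I -> (forall u, smax u -> I (u * g)) ->
  (codim I <= (codim (adjoin I g)).+1)%N.
Proof.
move=> lI mg; rewrite -addn1; apply: codim_of_dim_le => //.
  exact: adjoin_lattice.
by case: lI => sI _; apply: dim_le_adjoin.
Qed.

Lemma codim_adjoin_lt I g : is_lattice I -> ~ I g ->
  (codim (adjoin I g) < codim I)%N.
Proof.
move=> lI nIg; have [sI _] := lI; apply: codim_lt => //.
- exact: adjoin_lattice.
- exact: sub_adjoin.
- by move=> /(_ g (mem_adjoin _ sI)).
Qed.

Lemma smax_sub : smax `<=` sring. Proof. by move=> f []. Qed.

(** In a step K, K + R g with m g inside K, multiplication by g sends (W : K) to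
    (W : m), and (W : K + R g) is the preimage of W; so the colon drops by at most
    the type s of W. *)
Lemma codim_colon s W I J : is_lattice W -> W `<=` sring ->
  dim_le s W (colon W smax) -> is_lattice I -> is_lattice J ->
  I `<=` J -> J `<=` sring ->
  (codim (colon W J) + s * codim J <= codim (colon W I) + s * codim I)%N.
Proof.
move=> lW WR dimW lI lJ IJ JR.
pose P K := (codim (colon W K) + s * codim K <= codim (colon W I) + s * codim I)%N.
apply: (lattice_ind (P := P) lI lJ IJ) => [|K g]; first exact: leqnn.
rewrite /P => {P} lK IK KJ Jg nKg mg leK.
have [sK _] := lK; have [sW _] := lW.
have lt_adj := codim_adjoin_lt lK nKg.
have lC L : L `<=` sring -> is_lattice (colon W L) by move=> LR;
  apply: colon_lattice.
have KR : K `<=` sring by move=> f /KJ/JR.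
have le_adj : (codim (colon W (adjoin K g)) <= codim (colon W K) + s)%N.
  apply: codim_of_dim_le; try apply: lC => //.
    by apply: adjoin_sub => //; apply: JR.
  move=> h hK; have [i|z z0 Wz] := dimW (fun i => h i * g).
    split; first by apply: sringM; [case: (hK i)|apply: JR].
    by move=> u mu; rewrite -mulrA (mulrC g); apply: (hK i).2; apply: mg.
  exists z => //; set f := \sum_i _.
  have [Rf fK] : colon W K f.
    apply: submod_sum; first exact: colon_submod.
    by move=> i; apply: submodZ => //; apply: colon_submod.
  have Wfg : W (f * g).
    by rewrite /f mulr_suml; under eq_bigr => i _ do rewrite -mulrA.
  split=> // _ [i Ki [r Rr <-]]; rewrite mulrDr mulrCA.
  by apply: submodD => //; [apply: fK|apply: submodM].
have := leq_mul (leqnn s) lt_adj; rewrite mulnS; lia.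
Qed.

Lemma codim_dilate x n I : has_ord x n -> is_lattice I ->
  codim (dilate x I) = (codim I + n)%N.
Proof.
move=> xn lI; have x0 := has_ord_neq0 xn; have [N vI] := ords_bound lI.
have vxI m : ords (dilate x I) (n + m) = ords I m.
  apply/ordsP/ordsP => [[_ [i Ii <-] o]|[i Ii im]]; last first.
    by exists (x * i); [exists i|apply: has_ordM].
  exists i => //; have i0 : i != 0.
    by apply: contraTneq (has_ord_neq0 o) => ->; rewrite mulr0 eqxx.
  have [m' im'] := has_ord_exists i0.
  by have /eqP := has_ord_unique o (has_ordM xn im'); rewrite eqn_add2l => /eqP->.
have vxI_lt m : (m < n)%N -> ords (dilate x I) m = false.
  move=> lt_mn; apply/negP => /ordsP[_ [i Ii <-] [xim _]].
  have i0 : i != 0 by apply: contraNneq xim => ->; rewrite mulr0.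
  have [m' im'] := has_ord_exists i0.
  by rewrite (has_ordM xn im').2 ?eqxx // in xim; lia.
rewrite (codimE vI) (@codimE _ (n + N)%N) => [|m le_m]; last first.
  by rewrite -(subnKC (leq_trans (leq_addr N n) le_m)) vxI; apply: vI; lia.
rewrite /codim_below iotaD count_cat addnC; congr (_ + _)%N; last first.
  rewrite -[RHS](size_iota 0); apply/eqP; rewrite -all_count; apply/allP => m /=.
  by rewrite mem_iota => /andP[_ lt_m]; rewrite vxI_lt.
by rewrite add0n -[in iota n N](addn0 n) iotaDl count_map;
  apply: eq_count => m /=; rewrite vxI.
Qed.

(** * The type of a numerical semigroup ring *)

(** n - M is a pseudo-Frobenius number of H. *)
Definition pseudo_frobenius M n := (forall j, H j -> n <> (M + j)%N) /\
  forall j, H j -> (0 < j)%N -> exists2 i, H i & (n + j)%N = (M + i)%N.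

(** If h m is in (x), then h = x f / t^M for a series f, where t^M is any
    monomial in m.  The support of f lies in M + H up to the shifted
    pseudo-Frobenius numbers, so h is in (x) as soon as at most s coefficients
    of f vanish. *)
Lemma dim_socle s x : x != 0 ->
  (forall M, exists r : s.-tuple nat,
     forall n, pseudo_frobenius M n -> n \in r) ->
  dim_le s (dilate x sring) (colon (dilate x sring) smax).
Proof.
move=> x0 pfs h hP; have [M M_gt0 HM] : exists2 M, (0 < M)%N & H M.
  by have [N HN] := H_cofinite; exists N.+1 => //; apply: HN.
have mono_smax j : H j -> (0 < j)%N -> smax (fps_mono k j).
  by move=> Hj j_gt0; split; [apply: sring_mono|case: j j_gt0 {Hj}].
have /choice[f fP] i : exists f, sring f /\ x * f = h i * fps_mono k M.
  have [_ /(_ _ (mono_smax _ HM M_gt0))[f Rf ef]] := hP i.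
  by exists f.
have f_supp i n : fps_coef (f i) n != 0 ->
    (exists2 j, H j & n = (M + j)%N) \/ pseudo_frobenius M n.
  move=> fin; have [|nj] := pselect (exists2 j, H j & n = (M + j)%N);
    first by left.
  right; split=> [j Hj en|j Hj j_gt0]; first by apply: nj; exists j.
  have [_ /(_ _ (mono_smax _ Hj j_gt0))[r Rr er]] := hP i.
  have e : fps_mono k j * f i = fps_mono k M * r.
    apply: (fps_mulfI x0); rewrite mulrCA (fP i).2 [RHS]mulrCA er; ring.
  have := fps_coef_mono j (f i) (n + j); rewrite leq_addl addnK e fps_coef_mono.
  case: leqP => [le_M er'|_ e0]; last by move: fin; rewrite -e0 eqxx.
  by exists (n + j - M)%N; rewrite ?subnKC // Rr // er'.
have [p pP] := pfs M.
have [u u0 uA] := dependent_rows (\matrix_(i < s.+1, j < s) fps_coef (f i) (tnth p j)).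
exists (fun i => u 0 i).
  have /rV0Pn[i ui] := u0; by exists i.
set F := \sum_i fps_const (u 0 i) * f i.
have F_supp n : fps_coef F n != 0 -> exists2 j, H j & n = (M + j)%N.
  move=> Fn; apply: contrapT => nj; case/eqP: Fn; rewrite fps_coef_sum.
  have [/tnthP[j ->]|np] := boolP (n \in p).
    have /matrixP/(_ 0 j) := uA; rewrite !mxE => e; rewrite -[RHS]e.
    by apply: eq_bigr => i _; rewrite fps_coef_const mxE.
  apply: big1 => i _; rewrite fps_coef_const.
  have [->|/f_supp[//|/pP]] := eqVneq (fps_coef (f i) n) 0;
    first by rewrite mulr0.
  by rewrite (negPf np).
have [|r er] := @fps_mono_divides _ M F.
  move=> i lt_i; apply/eqP/negPn/negP => /F_supp[j _ ei]; lia.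
exists r.
  move=> j rj; have [|j' Hj' /eqP] := F_supp (M + j)%N.
    by rewrite er fps_coef_mono leq_addr addKn.
  by rewrite eqn_add2l => /eqP->.
apply: (fps_mulfI (has_ord_neq0 (has_ord_mono k M))).
rewrite mulrCA -er mulr_sumr mulr_sumr; apply: eq_bigr => i _.
by rewrite mulrCA (fP i).2; ring.
Qed.

(** The product m I. *)
Definition max_mul I : set (fps k) :=
  [set f | forall P : set (fps k), is_submod P ->
    (forall u i, smax u -> I i -> P (u * i)) -> P f].

Lemma max_mul_submod I : is_submod (max_mul I).
Proof.
split=> [P sP _|f g If Ig P sP IP|r f Rr If P sP IP]; first exact: submod0.
  by apply: submodD => //; [apply: If|apply: Ig].
by apply: submodM => //; apply: If.
Qed.

Lemma mem_max_mul I u i : smax u -> I i -> max_mul I (u * i).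
Proof. by move=> mu Ii P sP; apply. Qed.

Lemma max_mul_sub I : is_submod I -> max_mul I `<=` I.
Proof.
move=> sI f; apply=> // u i mu Ii; apply: submodM => //; exact: smax_sub.
Qed.

(** If N were smaller than I, the last step K of a composition series from N to I
    would contain N and m I, but not I. *)
Lemma nakayama N I : is_lattice N -> is_lattice I -> N `<=` I ->
  (forall K, is_lattice K -> N `<=` K -> max_mul I `<=` K -> I `<=` K) ->
    I `<=` N.
Proof.
move=> lN lI NI gen; have [sI _] := lI.
pose P J := J `<=` N \/ exists K, [/\ is_lattice K, N `<=` K, ~ (I `<=` K) &
  forall u f, smax u -> J f -> K (u * f)].
have [//||//|[K [lK NK nIK mIK]]] := lattice_ind (P := P) lN lI NI; first by left.
  move=> K g lK NK KI Ig nKg mg _; right; exists K; have [sK _] := lK.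
  split=> //; first by move=> /(_ g Ig).
  move=> u _ mu [i Ki [r Rr <-]]; rewrite mulrDr mulrCA.
  apply: submodD; rewrite //; apply: submodM => //; [exact: smax_sub|exact: mg].
case: nIK; apply: gen => // f; apply; first by case: lK.
by move=> u i mu Ii; apply: mIK.
Qed.

(** * Ideals of type one in a ring of type two *)

Section CanonicalIdeal.
Variables (C : set (fps k)) (x : fps k) (e : nat).
Hypotheses (lC : is_lattice C) (C_smax : C `<=` smax).
Hypotheses (Cx : C x) (xe : has_ord x e).
Hypothesis e_min : forall f i, C f -> (i < e)%N -> fps_coef f i = 0.
Hypothesis typeC : dim_le 1 (dilate x C) (colon (dilate x C) smax).
Hypothesis typeR : dim_le 2 (dilate x sring) (colon (dilate x sring) smax).

Let x0 : x != 0 := has_ord_neq0 xe.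
Let sC : is_submod C. Proof. by case: lC. Qed.
Let CR : C `<=` sring. Proof. by move=> f /C_smax[]. Qed.
Let Rx : sring x. Proof. exact: CR. Qed.
Let lR := sring_lattice.
Let RR : sring `<=` sring. Proof. by []. Qed.
Let lxC : is_lattice (dilate x C). Proof. exact: dilate_lattice. Qed.
Let lxR : is_lattice (dilate x sring). Proof. exact: dilate_lattice. Qed.
Let xCR : dilate x C `<=` sring. Proof. exact: dilate_sub. Qed.
Let xRR : dilate x sring `<=` sring. Proof. exact: dilate_sub. Qed.
Let xRC : dilate x sring `<=` C.
Proof. by move=> _ [r Rr <-]; rewrite mulrC; apply: submodM. Qed.

(** The colon into xC sends (x) to C and R to xC, two pairs of the same relative
    length, and it sends L = (xC : C) to a set containing C.  By [codim_colon], L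
    is thus no larger than (x). *)
Lemma colon_dilate_self : colon (dilate x C) C `<=` dilate x sring.
Proof.
set L := colon _ C.
have lL : is_lattice L by apply: colon_lattice.
have xRL : dilate x sring `<=` L.
  move=> _ [r Rr <-]; split; first by rewrite mulrC; apply: sringM.
  by move=> u Cu; exists (r * u); [apply: submodM|rewrite mulrA].
have LR : L `<=` sring by apply: colon_sring.
apply: (sub_of_codim lxR lL) => //; rewrite (codim_dilate xe lR).
have := codim_colon lxC xCR typeC lL lR LR RR.
have le1 : (codim (dilate x C) <= codim (colon (dilate x C) sring))%N.
  apply: codim_le => //; first exact: colon_lattice.
  by move=> h [_ /(_ 1 sring1)]; rewrite mulr1.
have le2 : (codim (colon (dilate x C) L) <= codim C)%N.
  apply: codim_le => //; first exact: colon_lattice.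
  by move=> c Cc; split=> [|l [_ /(_ c Cc)]]; [apply: CR|rewrite mulrC].
rewrite (codim_dilate xe lC) in le1; lia.
Qed.

Lemma max_mul_lattice : is_lattice (max_mul C).
Proof.
split; first exact: max_mul_submod.
exists (x * x); first by apply: mem_max_mul => //; apply: C_smax.
exact: has_ord_neq0 (has_ordM xe xe).
Qed.

(** By [colon_dilate_self], (xC : m C) lies in ((x) : m), whose quotient by (x) has
    length at most 2.  As xC : xC is R, [codim_colon] shows that m C / xC is at
    least as long as R / ((x) : m), that is, at most 2 shorter than C / xC. *)
Lemma codim_max_mul : (codim (max_mul C) <= codim C + 2)%N.
Proof.
have lmC := max_mul_lattice.
have mCR : max_mul C `<=` sring by move=> f /(max_mul_sub sC)/CR.
have xCm : dilate x C `<=` max_mul C.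
  by move=> _ [c Cc <-]; apply: mem_max_mul => //; apply: C_smax.
have := codim_colon lxC xCR typeC lxC lmC xCm mCR.
have le1 : (codim (colon (dilate x C) (dilate x C)) <= codim sring)%N.
  apply: codim_le => //; first exact: colon_lattice.
  move=> r Rr; split=> // _ [c Cc <-]; exists (r * c); last by ring.
  exact: submodM.
have lZ : is_lattice (colon (dilate x sring) smax).
  by apply: colon_lattice => //; apply: smax_sub.
have le2 : (codim (colon (dilate x sring) smax) <=
            codim (colon (dilate x C) (max_mul C)))%N.
  apply: codim_le => //; first exact: colon_lattice.
  move=> h [Rh hmC]; split=> // u mu; apply: colon_dilate_self.
  split=> [|c Cc]; first by apply: sringM => //; apply: smax_sub.
  by rewrite -mulrA; apply: hmC; apply: mem_max_mul.
have := codim_of_dim_le lxR lZ typeR.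
rewrite (codim_dilate xe lC) (codim_dilate xe lR); lia.
Qed.

(** The order e of x is the least order in C, hence missing from m C; at most one
    other order of C is missing, and y is chosen to have it. *)
Lemma two_generated : exists2 y, C y & C = adjoin (dilate x sring) y.
Proof.
have lmC := max_mul_lattice; have [smC _] := lmC.
have [N [eC em _ vm]] := codim_common lC lmC.
have gap2 n n' : ords C n -> ~~ ords (max_mul C) n -> ords C n' ->
    ~~ ords (max_mul C) n' -> n <> e -> n' <> e -> n = n'.
  move=> Cn mn Cn' mn' ne ne'; apply: contrapT => nn'.
  have := codim_max_mul; rewrite em eC (codim_gaps_sub N (max_mul_sub sC)).
  rewrite leq_add2l -size_filter leqNgt; case/negP.
  apply: (@uniq_leq_size _ [:: e; n; n']).
    by rewrite /= !inE; do ?[apply/andP; split]; rewrite ?negb_or; apply/eqP; lia.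
  have me : ~~ ords (max_mul C) e.
    apply/negP => /ordsP[f mf [/eqP fe _]]; apply: fe.
    suff : [set f | forall i, (i <= e)%N -> fps_coef f i = 0] f by apply.
    apply: mf => [|u i [_ u0] Ci j le_j].
      split=> // [g h g0 h0 i le_i|r g _ g0 i le_i].
        by rewrite fps_coefD g0 ?h0 ?addr0.
      by have [//|//|v _] := @mul_vanish _ r g 0 e.+1; apply: v.
    have [||v _] := @mul_vanish _ u i 1 e; last by apply: v; rewrite add1n.
      by case.
    by move=> p; apply: e_min.
  have ltN p : ~~ ords (max_mul C) p -> (p < N)%N.
    by move=> mp; rewrite ltnNge; apply: contra mp; apply: vm.
  have Ce : ords C e by apply/ordsP; exists x.
  by move=> p; rewrite !inE => /or3P[] /eqP->;
    rewrite mem_filter mem_iota /= ltN ?andbT //;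
     apply/andP.
have [y Cy yP] : exists2 y, C y & forall n, ords C n -> ~~ ords (max_mul C) n ->
    n = e \/ has_ord y n.
  have [[n [Cn mn ne]]|nex] :=
      pselect (exists n, [/\ ords C n, ~~ ords (max_mul C) n & n <> e]).
    have /ordsP[y Cy yn] := Cn; exists y => // n' Cn' mn'.
    have [->|/eqP ne'] := eqVneq n' e; first by left.
    by right; rewrite (gap2 n' n).
  by exists x => // n Cn mn; left; apply: contrapT => ne; apply: nex; exists n.
exists y => //; set D := adjoin _ y.
have lD : is_lattice D by apply: adjoin_lattice.
have DC : D `<=` C by apply: adjoin_sub.
apply/seteqP; split=> //; apply: nakayama => // K lK DK mK f Cf.
have [sK _] := lK.
have Kx : K x.
  by apply/DK/sub_adjoin => //; exists 1; rewrite ?mulr1 //; apply: sring1.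
have Ky : K y by apply/DK/mem_adjoin; case: lxR.
pose K' : set (fps k) := [set g | K g /\ C g].
have sK' : is_submod K'.
  split=> [|g h [Kg Cg] [Kh Ch]|r g Rr [Kg Cg]]; split;
    by [apply: submod0|apply: submodD|apply: submodM].
have lK' : is_lattice K' by split=> //; exists x.
have [] : K' f => //.
apply: (@mem_of_ords K' C 0%N) => // [g []//|n _ Cn].
have [/ordsP[g mg gn]|mn] := boolP (ords (max_mul C) n).
  by apply/ordsP; exists g => //; split; [apply: mK|apply: max_mul_sub].
by have [->|yn] := yP n Cn mn; apply/ordsP; [exists x|exists y].
Qed.

(** With A = ((x) : C): a strict inclusion between lattices K containing A stays
    strict for (x) + K y, because g y in (x) + K y forces g in A + K.  So the
    length of R / A is at most that of C / (x), and [codim_colon] with type 2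
    bounds ((x) : A). *)
Lemma codim_bidual :
  (2 * codim C <= codim (colon (dilate x sring) (colon (dilate x sring) C)) +
                  codim (dilate x sring))%N.
Proof.
have [y Cy eC] := two_generated.
set A := colon _ C.
have lA : is_lattice A by apply: colon_lattice.
have [sR _] := lR; have [sxR _] := lxR; have [sA _] := lA.
have AR : A `<=` sring by apply: colon_sring.
have le1 := codim_colon lxR xRR typeR lA lR AR RR.
have le2 : (codim (dilate x sring) <= codim (colon (dilate x sring) sring))%N.
  apply: codim_le => //; first exact: colon_lattice.
  by move=> h [_ /(_ 1 sring1)]; rewrite mulr1.
pose F K : set (fps k) := [set x * r + i * y | r in sring & i in K].
pose P K := (codim A + codim (F K) <= codim K + codim (dilate x sring))%N.
have lF K : is_submod K -> is_lattice (F K).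
  move=> sK; split; last first.
    exists x => //; exists 1; first exact: sring1.
    by exists 0; [apply: submod0|rewrite mulr1 mul0r addr0].
  split.
  - by exists 0; [apply: submod0|exists 0;
     [apply: submod0|rewrite mulr0 mul0r addr0]].
  - move=> _ _ [r Rr [i Ki <-]] [r' Rr' [i' Ki' <-]].
    exists (r + r'); first exact: sringD.
    by exists (i + i'); [apply: submodD|ring].
  - move=> s _ Rs [r Rr [i Ki <-]]; exists (s * r); first exact: sringM.
    by exists (s * i); [apply: submodM|ring].
have le3 : P sring.
  apply: (lattice_ind (P := P) lA lR AR) => [|K g lK AK KR Rg nKg mg].
    rewrite /P leq_add2l; apply: codim_le; rewrite //; first exact: lF.
    move=> _ [r Rr <-]; exists r => //.
    by exists 0; [apply: submod0|rewrite mul0r addr0].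
  rewrite /P => leK; have [sK _] := lK.
  have leKg := codim_adjoin lK mg.
  have ltF : (codim (F (adjoin K g)) < codim (F K))%N.
    apply: codim_lt; [exact: lF|by apply/lF/adjoin_submod| |].
      move=> _ [r Rr [i Ki <-]]; exists r => //; exists i => //.
      exact: sub_adjoin.
    move=> /(_ (g * y))[|r Rr [i Ki er]].
      exists 0; first exact: submod0.
      by exists g; [apply: mem_adjoin|rewrite mulr0 add0r].
    apply: nKg; rewrite -(subrK i g); apply: submodD => //; apply: AK.
    have Ri : sring i by apply: KR.
    split; first exact: (submodB sR).
    rewrite eC => _ [_ [s Rs <-] [r' Rr' <-]].
    exists ((g - i) * s + r' * r); last first.
      have exr : x * r = g * y - i * y by rewrite -er addrK.
      have -> : x * ((g - i) * s + r' * r) = (g - i) * (x * s) + r' * (x * r) by ring.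
      by rewrite exr; ring.
    apply: sringD; apply: sringM => //; exact: (submodB sR).
  lia.
have le4 : (codim C <= codim (F sring))%N.
  apply: codim_le => //; first exact: lF.
  move=> _ [r Rr [i Ri <-]]; apply: submodD => //; last exact: submodM.
  by apply: xRC; exists r.
rewrite /P in le3; lia.
Qed.
End CanonicalIdeal.

Lemma eventually_constant (u : nat -> nat) : (forall n, u n.+1 <= u n)%N ->
  exists v n0, forall n, (n0 <= n)%N -> u n = v.
Proof.
move=> u_noninc; have ex : exists v, `[< exists n, u n = v >].
  by exists (u 0%N); apply/asboolP; exists 0%N.
case: (ex_minnP ex) => v /asboolP[n0 e0] minv; exists v, n0 => n le_n.
apply/eqP; rewrite eqn_leq minv ?andbT; last by apply/asboolP; exists n.
rewrite -e0 -(subnKC le_n); elim: (n - n0)%N => [|d IHd]; first by rewrite addn0.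
by rewrite addnS (leq_trans (u_noninc _)).
Qed.

(** Division by x^n turns the P n into an increasing sequence of lattices in
    k[[t]], which becomes stationary. *)
Lemma codim_powers (P : nat -> set (fps k)) x e : has_ord x e ->
  (forall n, is_lattice (P n)) -> (forall n, dilate x (P n) `<=` P n.+1) ->
  (forall n f i, P n f -> (i < n * e)%N -> fps_coef f i = 0) ->
  exists v n0, forall n, (n0 <= n)%N -> codim (P n) = (n * e + v)%N.
Proof.
move=> xe lP xP vP.
have lV : is_lattice setT by split=> //; exists 1; rewrite ?oner_neq0.
have le_n n : (n * e <= codim (P n))%N.
  have mn := has_ord_mono k (n * e).
  apply: leq_trans (leq_addl (codim setT) _) _; rewrite -(codim_dilate mn lV).
  apply: codim_le => //; first by apply: dilate_lattice => //;
    apply: has_ord_neq0 mn.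
  by move=> f Pf; have [q ->] := fps_mono_divides (fun i => vP n f i Pf);
    exists q.
have [|v [n0 vn0]] := @eventually_constant (fun n => codim (P n) - n * e)%N.
  move=> n; have := codim_le (dilate_lattice (has_ord_neq0 xe) (lP n)) (lP n.+1) (xP n).
  by rewrite (codim_dilate xe) // => le; rewrite mulSn; lia.
by exists v, n0 => n /vn0 <-; rewrite subnKC.
Qed.

End Lattices.

(** * Submodules, quotients and lengths *)

Section GeneralModules.
Variable R : comNzRingType.
Implicit Types M N : lmodType R.

Definition prop_closed M (P : M -> Prop) :=
  P 0 /\ forall (r : R) u v, P u -> P v -> P (r *: u + v).

Definition prop_pred M (P : M -> Prop) (_ : prop_closed P) : {pred M} :=
  fun y => `[<P y>].

Section PropPred.
Variables (M : lmodType R) (P : M -> Prop) (cP : prop_closed P).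
Fact prop_pred_closed : submod_closed (prop_pred cP).
Proof.
have [P0 PD] := cP; split=> [|r u v]; first exact/asboolP.
by move=> /asboolP Pu /asboolP Pv; apply/asboolP/PD.
Qed.
HB.instance Definition _ :=
  GRing.isSubmodClosed.Build R M (prop_pred cP) prop_pred_closed.
End PropPred.

Lemma submod_of_prop M (P : M -> Prop) : prop_closed P ->
  exists S : submodClosed M, forall y, y \in S <-> P y.
Proof.
by move=> cP; exists (prop_pred cP : submodClosed M) => y; split=> /asboolP.
Qed.

Lemma quot_pi_eq M (S : submodClosed M) (u v : M) :
  quot_pi S u = quot_pi S v <-> u - v \in S.
Proof.
have e := Quotient.idealrBE (submod_pred S) u v.
split=> [/eqP uv|]; first by have : (u - v) \in submod_pred S by rewrite e.
by move=> uv; apply/eqP; rewrite /quot_pi -e.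
Qed.

Lemma quot_pi0 M (S : submodClosed M) u : quot_pi S u = 0 <-> u \in S.
Proof.
have e0 : quot_pi S 0 = 0 :> quot_mod S.
  by apply: (raddf0 (\pi_(Quotient.quot (submod_pred S)))%qT).
by rewrite -[X in _ = X]e0 quot_pi_eq subr0.
Qed.

Lemma quot_piP M (S : submodClosed M) (r : R) (u v : M) :
  (r *: (quot_pi S u : quot_mod S) + quot_pi S v = quot_pi S (r *: u + v)).
Proof. by rewrite quot_piD -quot_pi_scale. Qed.

Lemma len_le M n : (forall p S, @submod_chain R M p S -> (p <= n)%N) ->
  (len M <= n)%N.
Proof.
move=> bnd; rewrite /len; case: xgetP => [p _ [[S chS] _]|//]; exact: bnd chS.
Qed.

Lemma len_eq M n : is_length M n -> len M = n.
Proof.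
move=> lM; apply: (xget_unique _ lM) => p [[S chS] bp].
have [[S' chS'] bn] := lM.
by apply/eqP; rewrite eqn_leq (bn _ _ chS) (bp _ _ chS').
Qed.
End GeneralModules.

(** * Homomorphisms as fractions over a regular element *)

Section RegularElement.
Variables (R : comNzRingType) (x : R).
Hypothesis x_reg : injective ( *%R x).

(** The homomorphism u |-> h u / x. *)
Lemma divided_hom (M N : lmodType R) (i : {linear M -> R^o})
    (j : {linear N -> R^o}) (h : R) : injective j -> (forall u, exists v, x * j v = h * i u) ->
  exists phi : {linear M -> N}, forall u, x * j (phi u) = h * i u.
Proof.
move=> j_inj /choice[phi phiE].
have phi_lin : linear phi.
  move=> r u v; apply/j_inj/x_reg; rewrite phiE !linearP /=.
  have e1 := phiE u; have e2 := phiE v.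
  have -> : x * (r * j (phi u) + j (phi v)) = r * (x * j (phi u)) + x * j (phi v) by ring.
  rewrite e1 e2 /GRing.scale /=; ring.
pose phi' : {linear M -> N} := HB.pack phi (GRing.isLinear.Build R M N *:%R phi phi_lin).
by exists phi'.
Qed.

Lemma hom_funB (M N : lmodType R) (f g : Defs.hom M N) u :
  hom_fun (f - g) u = hom_fun f u - hom_fun g u.
Proof. by []. Qed.

Lemma hom_funZ (M N : lmodType R) r (f : Defs.hom M N) u :
  hom_fun (r *: f) u = r *: hom_fun f u.
Proof. by []. Qed.

Lemma hom_fun_linear (M N : lmodType R) (f : Defs.hom M N) r u :
  hom_fun f (r *: u) = r *: hom_fun f u.
Proof. exact: (linearZZ (f : {linear M -> N})). Qed.

Variables (m C : ideal R) (Cx : x \in C) (mx : x \in m).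

Definition incl : {linear submod_of C -> R^o} := val.

Definition divided r := exists2 y, y \in C & r = x * y.

(** An r with r m inside xC defines u |-> r u / x from m to C, whose class in
    Ext^1 vanishes exactly when r is in xC.  Two independent classes would give a
    chain of length 2. *)
Lemma ext1_dependent r0 r1 : is_length (ext1_residue m (submod_of C)) 1 ->
  (forall u, u \in m -> divided (r0 * u)) ->
  (forall u, u \in m -> divided (r1 * u)) ->
  divided r0 \/ exists r, divided (r1 - r * r0).
Proof.
move=> [_ len1] r0m r1m.
pose xm : submod_of m := Sub (x : R^o) mx.
have hom_ex r : (forall u, u \in m -> divided (r * u)) ->
    exists phi : Defs.hom (submod_of m) (submod_of C), incl (hom_fun phi xm) = r.
  move=> rP.
  have [|u|phi phiP] :=
    divided_hom (i := val : {linear submod_of m -> R^o}) (j := incl) (h := r).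
  - exact: val_inj.
  - have [y Cy ey] := rP _ (valP u); exists (Sub (y : R^o) Cy).
    exact: esym ey.
  - by exists phi; apply: x_reg; rewrite phiP; exact: mulrC.
have [phi0 phi0E] := hom_ex _ r0m; have [phi1 phi1E] := hom_ex _ r1m.
set E := ext1_residue m (submod_of C) in len1.
pose cl (phi : Defs.hom (submod_of m) (submod_of C)) : E := quot_pi _ phi.
have ext_eq phi psi : cl phi = cl psi ->
    divided (incl (hom_fun phi xm) - incl (hom_fun psi xm)).
  move=> /quot_pi_eq/asboolP[rho erho].
  have e : hom_fun rho (x : R^o) = hom_fun phi xm - hom_fun psi xm.
    by rewrite -hom_funB -erho.
  exists (incl (hom_fun rho 1)); first exact: valP.
  rewrite -(raddfB incl) -e -[in LHS](mulr1 x) -[x * 1]/(x *: (1 : R^o)).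
  by rewrite hom_fun_linear; exact: (linearZZ incl).
have clZ r phi : cl (r *: phi) = r *: cl phi by rewrite /cl -quot_pi_scale.
apply: contrapT => /not_orP[nr0 nr1].
have cl0 : cl phi0 <> 0.
  move=> e; apply: nr0; have := ext_eq phi0 0; rewrite phi0E.
  rewrite (_ : incl (hom_fun 0 xm) = 0) ?subr0 //; apply; rewrite e.
  by apply/esym/quot_pi0; apply: rpred0.
have cl1 r : cl phi1 <> r *: cl phi0.
  move=> e; apply: nr1; exists r; have := ext_eq phi1 (r *: phi0).
  have -> : incl (hom_fun (r *: phi0) xm) = r * r0.
    by rewrite hom_funZ -phi0E; apply: (linearZZ incl).
  by rewrite phi1E clZ; apply.
have [S0 S0P] : exists S : submodClosed E, forall y, y \in S <-> y = 0.
  by apply: submod_of_prop; split=> // r u v -> ->; rewrite scaler0 addr0.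
have [S1 S1P] : exists S : submodClosed E, forall y, y \in S <-> exists r, y = r *: cl phi0.
  apply: submod_of_prop; split=> [|r _ _ [s ->] [t ->]]; first by exists 0;
    rewrite scale0r.
  by exists (r * s + t); rewrite scalerDl scalerA.
have [S2 S2P] : exists S : submodClosed E, forall y, y \in S <-> True.
  exact: submod_of_prop.
suff ch : submod_chain 2 (fun i => if i == 0%N then S0 else if i == 1%N then S1 else S2).
  by have := len1 2%N _ ch.
case=> [|[|//]] _ /=; split.
- by move=> y /S0P->; apply/S1P; exists 0; rewrite scale0r.
- by exists (cl phi0); [apply/S1P; exists 1; rewrite scale1r|apply/negP => /S0P].
- by move=> y _; apply/S2P.
- by exists (cl phi1); [apply/S2P|apply/negP => /S1P[r /cl1]].
Qed.

Let N : lmodType R := submod_of C.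
Let inclD : dual N := incl.

(** Evaluation at the inclusion of C in R, through which the bidual becomes a set
    of ring elements. *)
Definition bidual_eval : {linear dual (dual N) -> R^o} := eval_fun inclD.

Let xC : N := Sub (x : R^o) Cx.

(** As homomorphisms, phi(x) times the inclusion is x times phi. *)
Lemma bidual_eval_dual (phi : dual N) (psi : dual (dual N)) :
  hom_fun phi xC * bidual_eval psi = x * hom_fun psi phi.
Proof.
have phix (u : N) : hom_fun phi xC * val u = x * hom_fun phi u.
  have e : val u *: xC = x *: u :> N.
    by apply: val_inj; rewrite !linearZ /= /GRing.scale /= mulrC.
  by have := congr1 (hom_fun phi) e; rewrite !hom_fun_linear mulrC.
have e : hom_fun phi xC *: inclD = x *: phi by apply: homP => u; apply: phix.
by have := congr1 (hom_fun psi) e; rewrite !hom_fun_linear.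
Qed.

Lemma bidual_eval_inj : injective bidual_eval.
Proof.
move=> psi psi' e; apply: homP => phi; apply: x_reg.
by rewrite -!bidual_eval_dual e.
Qed.

(** Apply psi to the functional u |-> r u / x. *)
Lemma bidual_eval_colon r : (forall u, u \in C -> exists v, r * u = x * v) ->
  forall psi, exists v, r * bidual_eval psi = x * v.
Proof.
move=> rC psi; have [||phi phiE] :=
    divided_hom (i := incl) (j := idfun : {linear R^o -> R^o}) (h := r).
- by move=> u v.
- by move=> u; have [v e] := rC _ (valP u); exists v.
have e : hom_fun (phi : dual N) xC = r.
  by apply: x_reg; rewrite [LHS](phiE xC); apply: mulrC.
by exists (hom_fun psi (phi : dual N)); rewrite -e bidual_eval_dual.
Qed.

Lemma bidual_eval_image r :
  r \in C <-> exists2 psi, psi \in lin_image (@bidual_map R N) & bidual_eval psi = r.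
Proof.
split=> [Cr|[psi /asboolP[u <-] <-]]; last exact: valP.
by exists (bidual_map (Sub (r : R^o) Cr)) => //; apply/asboolP; eexists.
Qed.

Lemma bidual_image_neq0 : x != 0 ->
  exists2 psi, psi \in lin_image (@bidual_map R N) & psi != 0.
Proof.
move=> x0; have /bidual_eval_image[psi Ipsi e] := Cx; exists psi => //.
by apply: contra x0 => /eqP psi0; rewrite -e psi0 raddf0.
Qed.
End RegularElement.

(** * Ideals of a numerical semigroup ring *)

(** The ring is given abstractly, with an embedding in k[[t]] whose image is
    k[[H]]. *)
Section NumericalSemigroupRing.
Variables (k : fieldType) (H : pred nat) (HS : numerical_semigroup H).
Variables (R : comNzRingType) (emb : {rmorphism R -> fps k}).
Hypotheses (emb_inj : injective emb) (emb_sring : forall r, @sring k H (emb r)).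
Hypothesis sring_emb : forall f, @sring k H f -> exists r, emb r = f.
Local Notation sring := (@sring k H).
Local Notation smax := (@smax k H).
Local Open Scope classical_set_scope.

Let H0 : H 0%N. Proof. by case: HS. Qed.
Let HD : forall m n, H m -> H n -> H (m + n)%N. Proof. by case: HS. Qed.

Lemma R_mulfI (x : R) : x != 0 -> injective ( *%R x).
Proof.
move=> x0 u v e; apply: emb_inj; apply: (@fps_mulfI _ (emb x)).
  by apply: contra x0 => /eqP e0; apply/eqP/emb_inj; rewrite rmorph0.
by rewrite -!rmorphM e.
Qed.

(** The recursion for the coefficients of 1 / f stays in the semigroup. *)
Lemma sring_inv (f q : fps k) : sring f -> f * q = 1 -> fps_coef f 0 != 0 ->
  sring q.
Proof.
move=> Rf fq f0 n; have [p] := ubnP n; elim: p n => // p IHp n lt_n qn.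
have [->|n_gt0] := posnP n; first exact: H0.
apply: contraT => nHn; have := fps_coef_mul f q n.
rewrite fq fps_coef1 (gtn_eqF n_gt0) big_ord_recl subn0 big1 => [/esym/eqP|i _].
  by rewrite addr0 mulf_eq0 (negPf f0) (negPf qn).
apply/eqP; apply: contraNT nHn; rewrite mulf_eq0 negb_or => /andP[fi qi].
have le_i : (lift ord0 i <= n)%N by rewrite -ltnS ltn_ord.
have lt_p : (n - lift ord0 i < p)%N by rewrite /= /bump /=; lia.
by rewrite -(subnKC le_i) HD ?(Rf _ fi) ?(IHp _ lt_p qi).
Qed.

Definition ideal_img (I : ideal R) : set (fps k) :=
  [set emb r | r in [set r | r \in I]].

Lemma ideal_img_emb (I : ideal R) r : ideal_img I (emb r) <-> r \in I.
Proof. by split=> [[s Is /emb_inj<-]|Ir]; [|exists r]. Qed.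

Lemma ideal_img_submod (I : ideal R) : is_submod H (ideal_img I).
Proof.
split.
- by exists 0; rewrite ?rmorph0 //; apply: rpred0.
- by move=> _ _ [r Ir <-] [s Is <-]; exists (r + s); rewrite ?rmorphD //;
   apply: rpredD.
- move=> _ _ /sring_emb[r <-] [s Is <-]; exists (r * s); rewrite ?rmorphM //.
  exact: (@rpredZ _ _ I r s).
Qed.

Lemma ideal_img_sring (I : ideal R) : ideal_img I `<=` sring.
Proof. by move=> _ [r _ <-]; apply: emb_sring. Qed.

Section MaximalIdeal.
Variables (m : ideal R) (hm : is_local m).
Lemma ideal_img_max : ideal_img m = smax.
Proof.
apply/seteqP; split=> [_ [r mr <-]|f [/sring_emb[r <-] r0]].
  split; first exact: emb_sring.
  apply/eqP/negPn/negP => r0; have /hm := mr; apply.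
  have [q e] := fps_inv r0.
  have [s es] := sring_emb (sring_inv (@emb_sring r) e r0).
  by exists s; apply: emb_inj; rewrite rmorphM rmorph1 es mulrC e.
apply/ideal_img_emb/hm => -[s /(congr1 emb)];
  rewrite rmorphM rmorph1 => /(congr1 (fun f => fps_coef f 0)).
rewrite fps_coef_mul big_ord1 r0 mulr0 => /esym/eqP.
by rewrite fps_coef1 oner_eq0.
Qed.
End MaximalIdeal.

Section Chains.
Variables (M : lmodType R) (theta : {linear M -> R^o}) (T : submodClosed M).
Hypothesis theta_inj : injective theta.
Hypothesis T_neq0 : exists2 t, t \in T & t != 0.

Definition theta_img (P : M -> Prop) : set (fps k) :=
  [set emb (theta z) | z in P].

Lemma theta_img_submod (P : M -> Prop) : prop_closed P ->
  is_submod H (theta_img P).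
Proof.
move=> [P0 PD]; split.
- by exists 0 => //; rewrite raddf0 rmorph0.
- move=> _ _ [u Pu <-] [v Pv <-]; exists (1 *: u + v); first exact: PD.
  by rewrite scale1r !raddfD.
- move=> _ _ /sring_emb[r <-] [u Pu <-]; exists (r *: u + 0); first exact: PD.
  by rewrite addr0 linearZ rmorphM.
Qed.

Lemma theta_img_lattice (P : M -> Prop) : prop_closed P ->
  (exists2 t, P t & t != 0) -> is_lattice H (theta_img P).
Proof.
move=> cP [t Pt t0]; split; first exact: theta_img_submod.
exists (emb (theta t)); first by exists t.
by apply: contra t0 => /eqP e; apply/eqP/theta_inj; rewrite raddf0;
  apply: emb_inj; rewrite rmorph0.
Qed.

(** Chains in M / T pull back to strict chains of lattices above the image of
    T. *)
Lemma chain_bound p (S : nat -> submodClosed (quot_mod T)) : submod_chain p S ->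
  (p + codim (theta_img (fun=> True)) <= codim (theta_img (fun t => t \in T)))%N.
Proof.
move=> chS; have [t Tt t0] := T_neq0.
have lat (P : M -> Prop) : prop_closed P -> P t -> is_lattice H (theta_img P).
  by move=> cP Pt; apply: theta_img_lattice => //; exists t.
pose K i := theta_img (fun z => quot_pi T z \in S i).
have lK i : is_lattice H (K i).
  apply: lat; last by move/quot_pi0: Tt => ->; apply: rpred0.
  have e0 : quot_pi T 0 = 0 by apply/quot_pi0/rpred0.
  split=> [|r u v Pu Pv]; first by rewrite e0 rpred0.
  by rewrite -quot_piP; apply: rpredD => //; apply: rpredZ.
have lM : is_lattice H (theta_img (fun=> True)) by apply: lat.
have lT : is_lattice H (theta_img (fun t => t \in T)).
  apply: lat => //; split=> [|r u v Pu Pv]; first exact: rpred0.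
  by apply: rpredD => //; apply: rpredZ.
have le_i i : (i <= p)%N -> (i + codim (K i) <= codim (K 0%N))%N.
  elim: i => [|i IHi] lt_ip; first by rewrite add0n.
  apply: leq_trans (IHi (ltnW lt_ip)); rewrite addSnnS leq_add2l.
  have [SS [y]] := chS i lt_ip; elim/quot_ind: y => z S1z S0z.
  apply: (codim_lt HS) => //; first by move=> _ [w Kw <-]; exists w => //;
    apply: SS.
  move=> /(_ (emb (theta z)))[|w S0w]; first by exists z.
  by move=> /emb_inj/theta_inj e; rewrite -e S0w in S0z.
have := le_i p (leqnn p).
have := codim_le HS (lK p) lM; have := codim_le HS lT (lK 0%N).
move=> le1 le2 le3; apply: leq_trans (le1 _); last first.
  by move=> _ [z Tz <-]; exists z => //; move/quot_pi0: Tz => ->; apply: rpred0.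
apply: leq_trans le3; rewrite leq_add2l; apply: le2.
by move=> _ [z _ <-]; exists z.
Qed.
End Chains.

Lemma ideal_img_lattice (I : ideal R) : (exists2 x, x \in I & x != 0) ->
  is_lattice H (ideal_img I).
Proof.
move=> [x Ix x0]; split; first exact: ideal_img_submod.
exists (emb x); first exact/ideal_img_emb.
by apply: contra x0 => /eqP e; apply/eqP/emb_inj; rewrite rmorph0.
Qed.

Lemma lattice_prop_closed (I : ideal R) K : is_submod H K ->
  prop_closed (fun y : quot_mod I => exists r : R, K (emb r) /\ quot_pi I r = y).
Proof.
move=> sK; split.
  by exists 0; split; [rewrite rmorph0; apply: submod0 sK|apply/quot_pi0/rpred0].
move=> r _ _ [u [Ku <-]] [v [Kv <-]]; exists (r * u + v); split.
  by rewrite rmorphD rmorphM; apply: (submodD sK) => //; apply: (submodM sK).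
by rewrite -quot_piP.
Qed.

(** [lattice_ind] builds a chain in R / I with one step per simple extension. *)
Lemma length_quot (I : ideal R) : (exists2 x, x \in I & x != 0) ->
  exists2 d, is_length (quot_mod I) d & (d + codim sring)%N = codim (ideal_img I).
Proof.
move=> nzI; have lI := ideal_img_lattice nzI.
have sI := ideal_img_submod I.
pose P K := exists d (S : nat -> submodClosed (quot_mod I)),
  [/\ submod_chain d S,
      forall y, y \in S d -> exists r : R, K (emb r) /\ quot_pi I r = y
    & (codim (ideal_img I) <= d + codim K)%N].
have [||d [S [chS _ le_d]]] := @lattice_ind _ H HS _ _ P lI (sring_lattice k HS)
    (@ideal_img_sring I).
- have [S SP] := submod_of_prop (lattice_prop_closed I sI).
  by exists 0%N, (fun=> S); split=> // y /SP.
- move=> K g lK IK KR Rg nKg mg [d [S [chS SdK le_d]]].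
  have [sK _] := lK; have sK' := adjoin_submod HS g sK.
  have [S' S'P] := submod_of_prop (lattice_prop_closed I sK').
  exists d.+1, (fun i => if (i <= d)%N then S i else S'); split.
  + move=> i; rewrite ltnS => le_id; rewrite le_id.
    have [lt_id|ge_id] := ltnP i d; first exact: chS.
    have -> : i = d by apply/eqP; rewrite eqn_leq le_id.
    split=> [y /SdK[r [Kr ey]]|].
      by apply/S'P; exists r; split=> //; apply: sub_adjoin Kr.
    have [g' eg] := sring_emb Rg; exists (quot_pi I g').
      by apply/S'P; exists g'; split=> //; rewrite eg; apply: mem_adjoin.
    apply/negP => /SdK[r [Kr /quot_pi_eq Irg]]; apply: nKg; rewrite -eg.
    have -> : emb g' = emb r - emb (r - g') by rewrite rmorphB subKr.
    by apply: (submodB HS sK) => //; apply/IK/ideal_img_emb.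
  + by rewrite ltnn => y /S'P.
  + by have := codim_adjoin HS lK mg; lia.
have bnd p S1 : @submod_chain _ (quot_mod I) p S1 ->
    (p + codim sring <= codim (ideal_img I))%N.
  move=> ch; have := @chain_bound R^o idfun I _ nzI p S1 ch.
  have -> : theta_img idfun (fun r : R^o => r \in I) = ideal_img I by [].
  have -> : theta_img idfun (fun=> True) = sring; last by apply=> u v.
  apply/seteqP; split=> [_ [r _ <-]|f /sring_emb[r <-]]; first exact: emb_sring.
  by exists r.
exists d; last by apply/eqP; rewrite eqn_leq (bnd _ _ chS).
split; first by exists S.
by move=> p S1 /bnd; lia.
Qed.

Lemma len_quot (I : ideal R) : (exists2 x, x \in I & x != 0) ->
  (len (quot_mod I) + codim sring)%N = codim (ideal_img I).
Proof. by move=> /length_quot[d /len_eq->]. Qed.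

Section Powers.
Variables (C : ideal R) (x : R) (e : nat).
Hypotheses (Cx : x \in C) (xe : has_ord (emb x) e).
Hypothesis e_min : forall f i, ideal_img C f -> (i < e)%N -> fps_coef f i = 0.

Lemma mem_ideal_mul (I J : ideal R) (u v : R) :
  u \in I -> v \in J -> u * v \in ideal_mul I J.
Proof.
move=> Iu Jv; apply/asboolP; exists 1%N, (fun=> u), (fun=> v); split=> //.
by rewrite big_ord1.
Qed.

(** Multiplication by x sends C^n into C^(n+1) and all elements of C^n have order
    at least n e, so [codim_powers] gives the Hilbert-Samuel function. *)
Lemma multiplicity_min_ord : multiplicity C = e.
Proof.
have x0 : x != 0 by apply: contraTneq (has_ord_neq0 xe) => ->;
  rewrite rmorph0 eqxx.
have nz n : exists2 y, y \in ideal_pow C n & y != 0.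
  elim: n => [|n [y Cy y0]]; first by exists 1; rewrite ?oner_neq0.
  exists (x * y); first exact: mem_ideal_mul.
  by apply: contra y0 => /eqP xy; apply/eqP/(R_mulfI x0); rewrite mulr0.
have lP n := ideal_img_lattice (nz n).
have [||v [n0 vE]] := codim_powers HS xe lP.
- by move=> n _ [_ [y Cy <-] <-]; exists (x * y); rewrite ?rmorphM //;
   apply: mem_ideal_mul.
- elim=> [//|n IHn] _ i [_ /asboolP[p [f [g [fg ->]]]] <-] lt_i.
  rewrite rmorph_sum fps_coef_sum big1 // => j _.
  have [Cf Cg] := fg j; rewrite rmorphM.
  have [q|q|vfg _] := @mul_vanish _ (emb (f j)) (emb (g j)) e (n * e).
  + by apply: e_min; exists (f j).
  + by apply: IHn; exists (g j).
  + by apply: vfg; rewrite -mulSn.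
have lenE n : (n0 <= n)%N ->
    (len (quot_mod (ideal_pow C n)))%:Z = e%:Z * n%:Z - ((codim sring)%:Z - v%:Z).
  move=> /vE; rewrite -(len_quot (nz n)) => /(congr1 Posz).
  by rewrite !PoszD PoszM; move: (Posz _) (Posz (codim _)) => L c0 eL; lia.
rewrite /multiplicity; apply: xget_unique.
  by exists ((codim sring)%:Z - v%:Z), n0.
move=> e' [e1 [n1 e'E]]; pose n := maxn n0 n1.
have le0 : (n0 <= n)%N by rewrite leq_maxl.
have le1 : (n1 <= n)%N by rewrite leq_maxr.
have := lenE n le0; have := e'E n le1.
have := lenE n.+1 (leqW le0); have := e'E n.+1 (leqW le1).
move=> -> E1 -> E2; nia.
Qed.
End Powers.

Section Canonical.
Variables (m : ideal R) (hm : is_local m).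
Variables (C : ideal R) (x : R).
Hypotheses (Cx : x \in C) (x0 : x != 0) (Cm : {subset C <= m}).
Let vx0 : emb x != 0.
Proof. by apply: contra x0 => /eqP e; apply/eqP/emb_inj; rewrite rmorph0. Qed.

(** The coefficient in R of [ext1_dependent] is replaced by its constant term,
    since the maximal ideal multiplies (xC : m) into xC. *)
Lemma socle_dim_le1 : is_length (ext1_residue m (submod_of C)) 1 ->
  dim_le 1 (dilate (emb x) (ideal_img C)) (colon H (dilate (emb x) (ideal_img C)) smax).
Proof.
move=> len1 h hP; have sC := ideal_img_submod C.
have divided_val r : divided x C r -> dilate (emb x) (ideal_img C) (emb r).
  by move=> [y Cy ->]; exists (emb y); [exists y|rewrite rmorphM].
have colon_div r : colon H (dilate (emb x) (ideal_img C)) smax (emb r) ->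
    forall u, u \in m -> divided x C (r * u).
  move=> [_ rP] u mu; have [|_ [y Cy <-] ey] := rP (emb u).
    by rewrite -(ideal_img_max hm); exists u.
  by exists y => //; apply: emb_inj; rewrite !rmorphM.
have [r0 er0] := sring_emb (hP ord0).1.
have [r1 er1] := sring_emb (hP (lift ord0 ord0)).1.
pose F (y0 y1 : k) (i : 'I_2) := if i == ord0 then y0 else y1.
have sumF y0 y1 : \sum_(i < 2) fps_const (F y0 y1 i) * h i =
    fps_const y0 * h ord0 + fps_const y1 * h (lift ord0 ord0).
  by rewrite big_ord_recl big_ord1.
have [||xCr0|[r xCr]] := ext1_dependent (R_mulfI x0) (Cm Cx) len1
  (r0 := r0) (r1 := r1).
- by apply: colon_div; rewrite er0.
- by apply: colon_div; rewrite er1.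
- exists (F 1 0); first by exists ord0; rewrite /F oner_eq0.
  rewrite sumF fps_const0 fps_const1 mul1r mul0r addr0 -er0.
  exact: divided_val.
have [z [u [mu er]]] := smaxP HS (@emb_sring r).
exists (F (- z) 1); first by exists (lift ord0 ord0); rewrite /F oner_eq0.
have := divided_val _ xCr; rewrite rmorphB rmorphM er er0 er1 => xCz.
rewrite sumF.
have -> : fps_const (- z) * h ord0 + fps_const 1 * h (lift ord0 ord0) =
    (h (lift ord0 ord0) - (fps_const z + u) * h ord0) + h ord0 * u.
  by rewrite fps_constN fps_const1; ring.
by apply: (submodD (dilate_submod _ sC)) => //; apply: (hP ord0).2.
Qed.

Let xR : set (fps k) := dilate (emb x) sring.

Lemma bidual_chain p S :
  @submod_chain _ (coker (@bidual_map _ (submod_of C))) p S ->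
  (p + codim (colon H xR (colon H xR (ideal_img C))) <= codim (ideal_img C))%N.
Proof.
move=> chS; have reg := R_mulfI x0.
have := chain_bound (bidual_eval_inj reg Cx) _ chS.
set T := theta_img _ (fun t => _ \in _).
have -> : T = ideal_img C.
  apply/seteqP; split=> [_ [psi Ipsi <-]|_ [r /bidual_eval_image[psi Ipsi <-] <-]].
    by exists (bidual_eval C psi) => //; apply/bidual_eval_image; exists psi.
  exact: (ex_intro2 _ _ psi Ipsi erefl).
have [psi0 Ipsi0 psi0_neq0] := bidual_image_neq0 Cx x0.
move=> /(_ (ex_intro2 _ _ psi0 Ipsi0 psi0_neq0)); apply: leq_trans.
have lC : is_lattice H (ideal_img C) by apply: ideal_img_lattice; exists x.
have CR := @ideal_img_sring C.
have lxR : is_lattice H xR by apply: dilate_lattice => //; apply: sring_lattice.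
have sxR : xR `<=` sring.
  by apply: dilate_sub; [apply: sring_submod|apply: emb_sring|].
rewrite leq_add2l; apply: (codim_le HS).
- by apply: theta_img_lattice (bidual_eval_inj reg Cx) _ _ _ => //; exists psi0.
- by apply: colon_lattice => //; apply: colon_sring.
move=> _ [psi _ <-]; split; first exact: emb_sring.
move=> _ [/sring_emb[r <-] rC].
have [|v e] := @bidual_eval_colon _ _ reg C Cx r _ psi.
  move=> u Cu; have [|_ /sring_emb[v <-] e] := rC (emb u); first by exists u.
  by exists v; apply: emb_inj; rewrite !rmorphM.
by exists (emb v); [apply: emb_sring|rewrite -!rmorphM -e mulrC].
Qed.
End Canonical.

(** Here d = codim (x) - codim C is the canonical degree, and chains in the
    cokernel of C -> C** have length at most codim C - codim ((x) : ((x) : C)). *)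
Lemma bideg_le_cdeg (m C : ideal R) : is_local m -> canonical_ideal m C ->
  (forall M, exists r : 2.-tuple nat,
     forall n, pseudo_frobenius H M n -> n \in r) ->
  ((bideg C)%:Z <= cdeg C)%R.
Proof.
move=> hm [[Cm _] [_ [u u0] _ len1 _]] pf2.
have nzC : exists2 x, x \in C & x != 0 by exists (val u); [apply: valP|].
have lC := ideal_img_lattice nzC.
have exn : exists n, ords (ideal_img C) n.
  by have [N vC] := ords_bound HS lC; exists N; apply: vC.
case: (ex_minnP exn) => e /ordsP[_ [x Cx <-] xe] min_e.
have e_min f i : ideal_img C f -> (i < e)%N -> fps_coef f i = 0.
  move=> Cf lt_ie; apply/eqP/negPn/negP => fi.
  have [n fn] : exists n, has_ord f n.
    by apply: has_ord_exists; apply: contraNneq fi => ->.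
  have : (e <= n)%N by apply: min_e; apply/ordsP; exists f.
  by move=> le_en; rewrite fn.2 ?eqxx // in fi; apply: leq_trans lt_ie le_en.
have vx0 := has_ord_neq0 xe.
have x0 : x != 0 by apply: contraTneq vx0 => ->; rewrite rmorph0 eqxx.
have Csmax : ideal_img C `<=` smax.
  by rewrite -(ideal_img_max hm) => _ [y Cy <-]; exists y => //; apply: Cm.
have vCx : ideal_img C (emb x) by exists x.
have bnd := codim_bidual HS lC Csmax vCx xe e_min
  (socle_dim_le1 hm Cx x0 Cm len1) (dim_socle HS vx0 pf2).
have exR := codim_dilate HS xe (sring_lattice k HS).
have lenC := len_quot nzC.
have le_C : (codim (ideal_img C) <= codim (dilate (emb x) sring))%N.
  apply: (codim_le HS) => //; first exact: dilate_lattice (sring_lattice k HS).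
  by move=> _ [r Rr <-]; rewrite mulrC; apply: (submodM (ideal_img_submod C)).
have le_bideg : (bideg C <= codim (dilate (emb x) sring) - codim (ideal_img C))%N.
  apply: len_le => p S chS; have := bidual_chain Cx x0 chS; lia.
rewrite /cdeg (multiplicity_min_ord Cx xe e_min); lia.
Qed.

End NumericalSemigroupRing.

Lemma semigroup_numerical (a b c : nat) : (0 < a)%N -> (0 < b)%N ->
  gcdn (gcdn a b) c = 1%N -> numerical_semigroup (semigroup_mem a b c).
Proof.
move=> a_gt0 b_gt0 abc1; split; [|exact: semigroup_memD|exact: semigroup_conductor].
by apply/semigroup_memP; exists 0%N, 0%N, 0%N; lia.
Qed.

Lemma pseudo_frobenius_le2 (a b c : nat) : (0 < a)%N -> (0 < b)%N -> (0 < c)%N ->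
  forall M, exists r : 2.-tuple nat, forall n,
    pseudo_frobenius (semigroup_mem a b c) M n -> n \in r.
Proof.
move=> a_gt0 b_gt0 c_gt0 M.
have shifted n : pseudo_frobenius (semigroup_mem a b c) M n ->
  shifted_pf a b c M n.
  move=> [nM pf].
  have gen g : semigroup_mem a b c g -> (0 < g)%N -> shifted_mem a b c M (n + g).
    by move=> Hg g_gt0; have [_ /semigroup_memP[i [j [l ->]]] e] := pf g Hg g_gt0;
       exists i, j, l.
  split.
  - by move=> [i [j [l e]]]; apply: nM e; apply/semigroup_memP; exists i, j, l.
  - by apply: gen => //; apply/semigroup_memP; exists 1%N, 0%N, 0%N; lia.
  - by apply: gen => //; apply/semigroup_memP; exists 0%N, 1%N, 0%N; lia.
  - by apply: gen => //; apply/semigroup_memP; exists 0%N, 0%N, 1%N; lia.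
have [[p pfp]|no_pf] := pselect (exists p, shifted_pf a b c M p); last first.
  by exists [tuple 0%N; 0%N] => n /shifted pfn; case: no_pf; exists n.
have [[q [pfq neq]]|no_q] := pselect (exists q, shifted_pf a b c M q /\ q <> p).
  exists [tuple p; q] => n /shifted pfn; rewrite !inE.
  have [->|epq|->] := at_most_two_pf pfn pfp pfq; rewrite ?eqxx ?orbT //.
  by case: neq.
exists [tuple p; p] => n /shifted pfn; rewrite !inE.
by have [_//|/eqP ne] := eqVneq n p; case: no_q; exists n.
Qed.

Theorem corollary9p4 (k : fieldType) (a b c : nat)
    (ha : (0 < a)%N) (hb : (0 < b)%N) (hc : (0 < c)%N)
    (habc : gcdn (gcdn a b) c = 1%N)
    (m : ideal (semigroup_ring k a b c)) (hm : is_local m)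
    (C : ideal (semigroup_ring k a b c)) (hC : canonical_ideal m C) :
  (bideg C)%:Z <= cdeg C.
Proof.
apply: (@bideg_le_cdeg k (semigroup_mem a b c) (semigroup_numerical ha hb habc)
  (semigroup_ring k a b c) (val : {rmorphism _ -> _})) => //.
- exact: val_inj.
- by move=> r; apply: (semigroup_ring_predP a b c (val r) (valP r)).
- move=> f Rf; have Pf : f \in @semigroup_ring_pred k a b c by apply/semigroup_ring_predP.
  by exists (Sub f Pf).
- exact: pseudo_frobenius_le2.
Qed.
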